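(* Let $(\Gamma,V)$ be a Coxeter system (with $V$ not assumed finite). Then the Coxeter group $\Gamma$ has finite virtual cohomological dimension (over $\mathbb{Z}$) if and only if there is a labelled graph morphism from the labelled graph $K^1(\Gamma,V)$ to some finite labelled graph.
   Context: A Coxeter system $(\Gamma,V)$ is a group $\Gamma$ with a generating set $V$ (possibly infinite) such that $\Gamma$ has a presentation $\langle V\mid (vw)^{m(v,w)}=1\ (v,w\in V)\rangle$, where $m(v,v)=1$ and, for $v\ne w$, $m(v,w)=m(w,v)$ is an integer $\ge 2$ or $\infty$ (in which case the relation is omitted). The function $m$ is determined by $(\Gamma,V)$, since $m(v,w)$ is the order of $vw$. A graph is a 1-dimensional simplicial complex (no loops, no multiple edges). A labelled graph is a graph with a function from its edge set to a set of labels; here the labels are integers $\ge 2$. A morphism of graphs is a simplicial map which does not collapse any edge. A morphism of labelled graphs is a morphism of graphs such that the image of each edge is an edge having the same label. $K(\Gamma,V)$ is the simplicial complex whose $n$-simplices are the $(n+1)$-element subsets of $V$ that generate finite subgroups of $\Gamma$. $K^1(\Gamma,V)$ is its 1-skeleton, labelled by giving the edge $\{v,w\}$ the label $m(v,w)$. A group has finite virtual cohomological dimension if it has a finite-index (necessarily torsion-free) subgroup of finite cohomological dimension over $\mathbb{Z}$. *)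

(* Defs.v *)
From HB Require Import structures.
From mathcomp Require Import all_boot all_order all_algebra.
From mathcomp Require Import boolp classical_sets functions cardinality.

Set Implicit Arguments.
Unset Strict Implicit.
Unset Printing Implicit Defensive.

Import GRing.Theory.

Local Open Scope classical_set_scope.
Local Open Scope card_scope.

(** The letter [(x, false)] stands for the generator [x], and [(x, true)] for
    its formal inverse. *)
Definition word (X : Type) := seq (X * bool).

Definition eval_word (G : groupType) (X : Type) (s : X -> G) (w : word X) : G :=
  (\prod_(l <- w) (if l.2 then (s l.1)^-1 else s l.1))%g.

(** The quotient of [word X] by this congruence is the group < X | R >, that
    is, the quotient of the free group on [X] by the normal closure of [R]. *)
Inductive pres_eq (X : Type) (R : set (word X)) : word X -> word X -> Prop :=
| pres_refl w : pres_eq R w w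
| pres_sym w1 w2 : pres_eq R w1 w2 -> pres_eq R w2 w1
| pres_trans w1 w2 w3 : pres_eq R w1 w2 -> pres_eq R w2 w3 -> pres_eq R w1 w3
| pres_cat w1 w2 w3 w4 :
    pres_eq R w1 w2 -> pres_eq R w3 w4 -> pres_eq R (w1 ++ w3) (w2 ++ w4)
| pres_cancel x b : pres_eq R [:: (x, b); (x, ~~ b)] [::]
| pres_relator r : R r -> pres_eq R r [::].

Definition has_presentation (G : groupType) (X : Type) (s : X -> G)
    (R : set (word X)) : Prop :=
  (forall g : G, exists w, eval_word s w = g) /\
  (forall w1 w2, eval_word s w1 = eval_word s w2 <-> pres_eq R w1 w2).

(** The value [None] stands for infinity. *)
Definition coxeter_matrix (X : Type) (m : X -> X -> option nat) : Prop :=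
  [/\ forall v, m v v = Some 1,
      forall v w, m v w = m w v
    & forall v w k, v <> w -> m v w = Some k -> 2 <= k].

Definition coxeter_relators (X : Type) (m : X -> X -> option nat) :
    set (word X) :=
  [set r | exists v w k, m v w = Some k /\
           r = flatten (nseq k [:: (v, false); (w, false)])].

Record coxeter_system (G : groupType) (V : set G) (m : V -> V -> option nat) :
    Prop := CoxeterSystem {
  cox_matrix : coxeter_matrix m;
  cox_presentation :
    has_presentation (fun v : V => val v) (coxeter_relators m) }.

(** [lg_label] is only meaningful on edges. *)
Record labelled_graph := LabelledGraph {
  lg_vertex :> Type;
  lg_edge : lg_vertex -> lg_vertex -> Prop;
  lg_label : lg_vertex -> lg_vertex -> nat;
  lg_edge_irr : forall x, ~ lg_edge x x;
  lg_edge_sym : forall x y, lg_edge x y -> lg_edge y x;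
  lg_label_sym : forall x y, lg_edge x y -> lg_label x y = lg_label y x;
  lg_label_ge2 : forall x y, lg_edge x y -> 2 <= lg_label x y }.

Definition lg_finite (D : labelled_graph) : Prop := finite_set [set: D].

Definition lg_morphism (D E : labelled_graph) (f : D -> E) : Prop :=
  forall x y, lg_edge x y ->
    lg_edge (f x) (f y) /\ lg_label (f x) (f y) = lg_label x y.

Definition generated (G : groupType) (S : set G) : set G :=
  smallest [set H : set G | group_closed (mem H)] S.

Definition coxeter_simplex (G : groupType) (V : set G) (n : nat) (s : set G) :
    Prop :=
  [/\ s `<=` V, s #= `I_n.+1 & finite_set (generated s)].

(** Each generator spans a subgroup of order at most 2, so the vertex set of
    the simplicial complex [coxeter_simplex V] is the whole of [V]. *)
Definition K1_edge (G : groupType) (V : set G) (v w : V) : Prop :=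
  coxeter_simplex V 1 [set val v; val w].

(** If [v] and [w] span an edge then [m v w] is finite, since it is the order
    of v w; hence the default value 2 is never used on an edge. *)
Definition K1_label (G : groupType) (V : set G) (m : V -> V -> option nat)
    (v w : V) : nat :=
  odflt 2 (m v w).

Lemma K1_edge_irr (G : groupType) (V : set G) (v : V) : ~ K1_edge v v.
Proof.
case=> _ + _; rewrite setUid => c2.
have c1 : [set val v] #= `I_1 by exact: card_set1.
have : `I_2 #= `I_1 by apply: card_eq_trans c1; rewrite card_eq_sym.
by move/card_eq_II.
Qed.

Lemma K1_edge_sym (G : groupType) (V : set G) (v w : V) :
  K1_edge v w -> K1_edge w v.
Proof. by rewrite /K1_edge setUC. Qed.

Lemma K1_label_sym (G : groupType) (V : set G) (m : V -> V -> option nat)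
    (cox : coxeter_system m) (v w : V) :
  K1_edge v w -> K1_label m v w = K1_label m w v.
Proof. by case: cox => -[_ mC _] _ _; rewrite /K1_label mC. Qed.

Lemma K1_label_ge2 (G : groupType) (V : set G) (m : V -> V -> option nat)
    (cox : coxeter_system m) (v w : V) :
  K1_edge v w -> 2 <= K1_label m v w.
Proof.
case: cox => -[_ _ m_ge2] _ vw; rewrite /K1_label.
case mvw: (m v w) => [k|//] /=; apply: m_ge2 mvw => eq_vw.
by rewrite eq_vw in vw; apply: K1_edge_irr vw.
Qed.

Definition K1 (G : groupType) (V : set G) (m : V -> V -> option nat)
    (cox : coxeter_system m) : labelled_graph :=
  LabelledGraph (@K1_edge_irr G V) (@K1_edge_sym G V)
    (K1_label_sym cox) (K1_label_ge2 cox).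

(** A left module over the integral group ring of [G] is encoded as an abelian
    group with an additive action of [G]. *)
Record gmodule (G : groupType) := GModule {
  gm_carrier :> zmodType;
  gm_act : G -> {additive gm_carrier -> gm_carrier};
  gm_act1 : forall x, gm_act 1%g x = x;
  gm_actM : forall g h x, gm_act (g * h)%g x = gm_act g (gm_act h x) }.

Record gm_hom (G : groupType) (M N : gmodule G) := GmHom {
  gm_fun :> {additive M -> N};
  gm_funE : forall (g : G) (x : M), gm_fun (gm_act M g x) = gm_act N g (gm_fun x) }.

Definition gm_surjective (G : groupType) (M N : gmodule G) (f : gm_hom M N) :
    Prop :=
  forall y, exists x, f x = y.

Definition gm_exact (G : groupType) (M N P : gmodule G)
    (f : gm_hom M N) (g : gm_hom N P) : Prop :=
  forall y, g y = 0%R <-> exists x, f x = y.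

Definition gm_projective (G : groupType) (P : gmodule G) : Prop :=
  forall (M N : gmodule G) (p : gm_hom M N) (f : gm_hom P N),
    gm_surjective p -> exists h : gm_hom P M, forall x, p (h x) = f x.

Definition gm_trivial (G : groupType) : gmodule G :=
  @GModule G int (fun=> idfun) (fun=> erefl) (fun _ _ _ => erefl).

(** The resolution 0 -> P_n -> ... -> P_0 -> M -> 0 is extended by zero in
    degrees above [n]. *)
Definition has_proj_resolution (G : groupType) (M : gmodule G) (n : nat) :
    Prop :=
  exists (P : nat -> gmodule G) (d : forall i, gm_hom (P i.+1) (P i))
         (e : gm_hom (P 0) M),
    [/\ forall i, gm_projective (P i),
        gm_surjective e,
        gm_exact (d 0) e,
        forall i, gm_exact (d i.+1) (d i)
      & forall i, n < i -> forall x : P i, x = 0%R].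

Definition finite_cd (G : groupType) : Prop :=
  exists n, has_proj_resolution (gm_trivial G) n.

Record subgroup_of (G : groupType) (H : groupClosed G) := SubgroupOf {
  subgroup_val :> G;
  subgroup_valP : subgroup_val \in H }.

HB.instance Definition _ (G : groupType) (H : groupClosed G) :=
  [isSub of subgroup_of H for @subgroup_val G H].
HB.instance Definition _ (G : groupType) (H : groupClosed G) :=
  [Choice of subgroup_of H by <:].

Lemma groupClosed_closed (G : groupType) (H : groupClosed G) :
  group_closed (fun x : G => x \in H).
Proof. by split; [exact: gpred1 | exact: gpredF]. Qed.

HB.instance Definition _ (G : groupType) (H : groupClosed G) :=
  SubChoice_isSubGroup.Build G _ (subgroup_of H) (groupClosed_closed H).

Definition left_coset (G : groupType) (H : set G) (g : G) : set G :=
  [set (g * h)%g | h in H].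

Definition finite_index (G : groupType) (H : set G) : Prop :=
  finite_set (range (left_coset H)).

Definition finite_vcd (G : groupType) : Prop :=
  exists H : groupClosed G,
    finite_index [set` H] /\ finite_cd (subgroup_of H).

(* Main.v *)
From HB Require Import structures.
Require Import Defs.
From mathcomp Require Import all_boot all_order all_algebra.
From mathcomp Require Import boolp classical_sets functions cardinality.
From mathcomp Require Import fsbigop reals Rstruct trigo.
From mathcomp Require Import zify ring lra.

Set Implicit Arguments.
Unset Strict Implicit.
Unset Printing Implicit Defensive.

Import GRing.Theory.
Local Open Scope classical_set_scope.

(** Write [G] for the Coxeter group.

    From a finite dimension to a finite graph.  Let [K] be a subgroup of finite
    index and of finite cohomological dimension.  Then [K] is torsion free
    ([finite_cd_torsion_free]): the Tate cohomology of a finite cyclic subgroup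
    vanishes on projective modules, hence, by shifting dimensions along a finite
    resolution, it would vanish on the trivial module, which it does not.  The
    group [G] permutes the finite set of cosets of [K], and an element of finite
    order acts with the same order, since a power that fixes the coset [K] is a
    torsion element of [K].  The product of two generators has the order
    prescribed by the Coxeter matrix ([order_gen_mul]).  So sending a generator
    to its permutation is a morphism to the finite graph of the involutions of
    the cosets, where an edge is labelled by the order of the product.

    From a finite graph to a finite dimension.  A morphism to a finite graph
    colours the generators by [n] colours, with labels between colours.

    The subgroup.  The labels define reflections on the functions from the
    colours to the reals, with Cartan coefficients [- 2 cos (pi / k)], and [G]
    acts through them.  The action is not faithful, but the positivity argument
    of Tits shows that it is faithful on each finite subgroup generated by
    generators ([act_faithful]).  It preserves the functions with values in the
    lattice spanned by the numbers [2 cos (j pi / N)], and only finitely many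
    functions are images of the constant function [2] under those finite
    subgroups; so the action modulo a suitable integer still separates them, and
    its kernel [K] is normal, of finite index, and meets all these finite
    subgroups trivially ([detecting_subgroup]).

    The resolution.  For a finite set [T] of generators, let [A_T] be the left
    ideal of the [x] in the integral group ring of [G] with [x t = - x] for all
    [t] in [T].  It is zero unless [T] generates a finite subgroup [G_T], because
    elements of the group ring have finite support; otherwise the cosets [w G_T]
    give a basis of [A_T], up to signs.  [K] permutes these cosets freely, so
    [A_T] is projective over [K] ([chain_projective]).  If [S] is a subset of [T]
    then [A_S] contains [A_T], so that the simplicial boundary formula makes the
    sum of the [A_T], graded by the cardinality of [T], into a complex (it is the
    cellular chain complex of the Davis complex, with its Coxeter cells).  As
    colours are distinct on each [T] with [G_T] finite, it stops in degree [n].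

    Exactness ([chain_exact]).  Let [w] have maximal length in the support of a
    cycle.  By anti-invariance each [T] that occurs at [w] consists of descents
    of [w].  The part of the cycle at [w] is thus a cycle in the full simplex on
    the descents of [w], and it is the boundary of a cone as soon as there is a
    descent.  The cone extends to a chain of the complex, because [w] is the
    longest element of [w G_T] for every set [T] of descents of [w]
    ([len_longest], a consequence of the exchange condition [len_exchange]).
    Subtracting its boundary removes [w] from the support and adds only shorter
    elements. *)

(** * Words in the generators *)

Local Open Scope group_scope.

Definition prd (G : groupType) (V : set G) (s : seq V) : G :=
  \prod_(v <- s) val v.

Section Words.
Variables (G : groupType) (V : set G).

Lemma prd_nil : prd (V := V) [::] = 1. Proof. by rewrite /prd big_nil. Qed.

Lemma prd_cons (v : V) s : prd (v :: s) = val v * prd s.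
Proof. by rewrite /prd big_cons. Qed.

Lemma prd_cat (s t : seq V) : prd (s ++ t) = prd s * prd t.
Proof. by rewrite /prd big_cat. Qed.

Lemma prd_rcons s (v : V) : prd (rcons s v) = prd s * val v.
Proof. by rewrite -cats1 prd_cat prd_cons prd_nil mulg1. Qed.

End Words.

Section Coxeter.
Variables (G : groupType) (V : set G) (m : V -> V -> option nat).
Hypothesis cox : coxeter_system m.

Lemma cox_rel v w k : m v w = Some k -> (val v * val w) ^+ k = 1.
Proof.
case: cox => _ [_ rel] mvw.
have /rel : pres_eq (coxeter_relators m)
    (flatten (nseq k [:: (v, false); (w, false)])) [::].
  by apply: pres_relator; exists v, w, k.
rewrite /eval_word big_nil => <-.
elim: k {mvw} => [|k IH]; first by rewrite big_nil.
by rewrite expgS IH /= !big_cons mulgA.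
Qed.

Lemma cox_diag v : m v v = Some 1%N.
Proof. by case: cox => -[]. Qed.

Lemma cox_sym v w : m v w = m w v.
Proof. by case: cox => -[]. Qed.

Lemma cox_ge2 v w k : v <> w -> m v w = Some k -> (2 <= k)%N.
Proof. by case: cox => -[_ _ + _]; apply. Qed.

Lemma genV (v : V) : (val v)^-1 = val v.
Proof. by apply/mulg1_eq; rewrite -[_ * _]expg1 (cox_rel (cox_diag v)). Qed.

Lemma genK (v : V) : val v * val v = 1.
Proof. by rewrite -{1}genV mulVg. Qed.

Lemma mulgenK (v : V) g : g * val v * val v = g.
Proof. by rewrite -mulgA genK mulg1. Qed.

Lemma genKmul (v : V) g : val v * (val v * g) = g.
Proof. by rewrite mulgA genK mul1g. Qed.

Lemma word_of g : exists s : seq V, prd s = g.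
Proof.
case: cox => _ [gen _]; case: (gen g) => w <-.
exists (map fst w); rewrite /prd /eval_word big_map; apply: eq_bigr => -[v []] _ //=.
by rewrite genV.
Qed.

Lemma prdV (s : seq V) : (prd s)^-1 = prd (rev s).
Proof.
elim: s => [|v s IH]; first by rewrite prd_nil invg1.
by rewrite prd_cons invgM IH rev_cons prd_rcons genV.
Qed.

(** The universal property of the presentation.  The sign, the inversions and the
    reflection representations of the group are all obtained from it. *)
Lemma coxeter_action (X : Type) (sigma : V -> X -> X) :
  (forall v w k, m v w = Some k ->
     forall x, iter k (fun x => sigma v (sigma w x)) x = x) ->
  exists act : G -> X -> X,
    [/\ forall x, act 1 x = x,
        forall g h x, act (g * h) x = act g (act h x)
      & forall (v : V) x, act (val v) x = sigma v x].
Proof.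
move=> rel.
have sK v x : sigma v (sigma v x) = x by apply: (rel _ _ _ (cox_diag v)).
pose ev (w : word V) x := foldr (fun l => sigma l.1) x w.
have ev_cat w1 w2 x : ev (w1 ++ w2) x = ev w1 (ev w2 x) by rewrite /ev foldr_cat.
have ev_eq w1 w2 : pres_eq (coxeter_relators m) w1 w2 -> ev w1 =1 ev w2.
  elim=> // {w1 w2} [w1 w2 _ IH x|w1 w2 w3 _ IH1 _ IH2 x|w1 w2 w3 w4 _ IH1 _ IH2 x|v b x|r].
  - by rewrite IH.
  - by rewrite IH1 IH2.
  - by rewrite !ev_cat IH2 IH1.
  - by rewrite /= sK.
  - move=> [v [w [k [mvw ->]]]] x; rewrite -[RHS](rel _ _ _ mvw x) /ev.
    by elim: k {mvw} => //= k ->.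
case: cox => _ [gen relE].
pose wd g := projT1 (cid (gen g)).
have wdE g : eval_word (fun v : V => val v) (wd g) = g by rewrite /wd; case: cid.
exists (fun g => ev (wd g)); split=> [x|g h x|v x].
- rewrite (@ev_eq _ [::])//; apply/relE; rewrite wdE /eval_word big_nil//.
- rewrite -ev_cat; apply: ev_eq; apply/relE.
  by rewrite wdE /eval_word big_cat /= -!/(eval_word _ _) !wdE.
- rewrite (@ev_eq _ [:: (v, false)])//; apply/relE.
  by rewrite wdE /eval_word big_cons big_nil mulg1.
Qed.

Lemma coxeter_sign : exists sgn : G -> bool,
  (forall g h, sgn (g * h) = sgn g (+) sgn h) /\ (forall v : V, sgn (val v)).
Proof.
have [|act [act1 actM actv]] := @coxeter_action bool (fun _ => negb).
  by move=> _ _ k _ b; elim: k => //= k ->; rewrite negbK.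
have actE g b : act g b = act g false (+) b.
  case: (word_of g) => s <-; elim: s b => [|v s IH] b.
    by rewrite prd_nil !act1.
  by rewrite prd_cons !actM !actv IH addNb.
exists (act^~ false); split=> [g h|v]; first by rewrite actM actE.
by rewrite actv.
Qed.

Lemma even_periodic_count (T : eqType) (X : nat -> T) (g : T) k :
  (forall j, X (k + j) = X j) ->
  ~~ odd (\sum_(i < k) ((g == X i.*2) + (g == X i.*2.+1))).
Proof.
move=> per.
have -> : \sum_(i < k) ((g == X i.*2) + (g == X i.*2.+1)) =
    \sum_(0 <= j < k + k) (g == X j).
  rewrite addnn; move: k {per}; elim => [|k IH]; first by rewrite big_ord0 big_geq.
  by rewrite big_ord_recr /= IH doubleS !big_nat_recr //= addnA.
rewrite (big_cat_nat (n := k)) ?leq_addr //=.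
have -> : \sum_(k <= j < k + k) (g == X j) = \sum_(0 <= j < k) (g == X j).
  rewrite -{1}[k]add0n big_addn addnK.
  by apply: eq_bigr => j _; rewrite addnC per.
by rewrite addnn odd_double.
Qed.

(** The generator [v] acts on pairs of an element and a sign by conjugating the
    element and by changing the sign exactly at [v].  This respects the relator
    of [v] and [w], because the elements at which the sign changes along it form
    a sequence of even length [2 k] which repeats after [k] steps.  [inv g r] is
    the resulting change of sign: for a reflection [r] it tells whether [r] is an
    inversion of [g], and the value does not depend on a word for [g]. *)
Lemma coxeter_cocycle : exists inv : G -> G -> bool,
  (forall g h r, inv (g * h) r = inv h r (+) inv g (h * r * h^-1)) /\
  (forall (v : V) r, inv (val v) r = (r == val v)).
Proof.
pose sigma (v : V) (p : G * bool) :=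
  (val v * p.1 * (val v)^-1, p.2 (+) (p.1 == val v)).
have [v w k mvw [g b]|act [act1 actM actv]] := @coxeter_action _ sigma.
  pose c := val v * val w.
  have ck : c ^+ k = 1 by exact: cox_rel.
  have cV : c^-1 = val w * val v by rewrite /c invgM !genV.
  have cV' : (val w)^-1 * (val v)^-1 = c^-1 by rewrite cV !genV.
  have wc i : val w * c ^+ i = c^-1 ^+ i * val w.
    elim: i => [|i IH]; first by rewrite !expg0 mulg1 mul1g.
    by rewrite expgSr mulgA IH expgSr -!mulgA cV /c !mulgA.
  (* The element met at step [l], counting letters from the right, is
     [c^-1 ^+ l * val w]. *)
  have main j : iter j (fun p => sigma v (sigma w p)) (g, b) =
      (c ^+ j * g * (c ^+ j)^-1,
       b (+) odd (\sum_(i < j) ((g == c^-1 ^+ i.*2 * val w)%g +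
                               (g == c^-1 ^+ i.*2.+1 * val w)%g))).
    elim: j => [|j IH].
      by rewrite /= expg0 big_ord0 mul1g invg1 mulg1 addbF.
    rewrite iterS IH /sigma /= big_ord_recr /=; congr pair.
      by rewrite expgS invgM -/c [in RHS]/c -cV' !mulgA.
    rewrite !oddD !oddb -!addbA; congr (_ (+) (_ (+) _)).
    have conjE x y : (c ^+ j * x * (c ^+ j)^-1 == y) = (x == c^-1 ^+ j * y * c ^+ j).
      by rewrite expVgn; apply/eqP/eqP => [<-|->]; rewrite !mulgA ?mulgVK ?mulVg ?mulgV ?mul1g // mulgK.
    have e1 : c^-1 ^+ j * val w * c ^+ j = c^-1 ^+ j.*2 * val w.
      by rewrite -mulgA wc mulgA -expgnDr addnn.
    congr (_ (+) _); first by rewrite conjE e1.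
    have -> : (val w * (c ^+ j * g * (c ^+ j)^-1) * (val w)^-1 == val v) =
        (c ^+ j * g * (c ^+ j)^-1 == c^-1 * val w).
      rewrite cV; apply/eqP/eqP => [<-|->].
        by rewrite !mulgA genK mul1g genV mulgenK.
      by rewrite !mulgA genK mul1g genV mulgenK.
    by rewrite conjE !mulgA -expgSr -mulgA wc mulgA -expgnDr addSn addnn.
  rewrite main ck mul1g invg1 mulg1; congr pair.
  rewrite (negbTE (@even_periodic_count _ (fun i => c^-1 ^+ i * val w) g k _)) ?addbF // => j.
  by rewrite expgnDr expVgn ck invg1 mul1g.
have actE g r b : act g (r, b) = (g * r * g^-1, b (+) (act g (r, false)).2).
  case: (word_of g) => s <-; elim: s b => [|v s IH] b.
    by rewrite prd_nil !act1 mul1g invg1 mulg1 addbF.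
  by rewrite prd_cons !actM !actv IH (IH false) /sigma /= invgM !mulgA addbA.
exists (fun g r => (act g (r, false)).2); split=> [g h r|v r].
  by rewrite actM (actE h) /= actE.
by rewrite actv.
Qed.

End Coxeter.

(** * Length *)

Lemma cat_split_letter (T : Type) (x s s1 s2 : seq T) (a : T) :
  x ++ s = s1 ++ a :: s2 ->
  (exists x1 x2, x = x1 ++ a :: x2 /\ s1 ++ s2 = x1 ++ x2 ++ s) \/
  (exists t1 t2, s = t1 ++ a :: t2 /\ s1 ++ s2 = x ++ t1 ++ t2).
Proof.
elim: x s1 => [|b x IH] s1 /=; first by right; exists s1, s2.
case: s1 => [[-> <-]|c s1 [-> /IH]] /=; first by left; exists [::], x.
case=> [[x1 [x2 [-> ->]]]|[t1 [t2 [-> ->]]]].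
  by left; exists (c :: x1), x2.
by right; exists t1, t2.
Qed.

Section Length.
Variables (G : groupType) (V : set G) (m : V -> V -> option nat).
Hypothesis cox : coxeter_system m.

Implicit Types (s t : seq V) (g h : G).

Definition has_word (g : G) (n : nat) : bool :=
  `[< exists2 s : seq V, prd s = g & size s = n >].

Lemma has_wordP (g : G) : exists n, has_word g n.
Proof. case: (word_of cox g) => s e; exists (size s); apply/asboolP; exists s => //. Qed.

Definition len (g : G) : nat := ex_minn (has_wordP g).

Lemma len_prd s : (len (prd s) <= size s)%N.
Proof.
rewrite /len; case: ex_minnP => n _; apply.
by apply/asboolP; exists s.
Qed.

Lemma len_word g : exists2 s : seq V, prd s = g & size s = len g.
Proof. by rewrite /len; case: ex_minnP => n /asboolP. Qed.

Lemma len1 : len 1 = 0%N.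
Proof. by apply/eqP; rewrite -leqn0 -[1](prd_nil V) (len_prd [::]). Qed.

Lemma len_eq0 g : len g = 0%N -> g = 1.
Proof.
by case: (len_word g) => s <- <- /eqP/nilP ->; rewrite prd_nil.
Qed.

Lemma lenM g h : (len (g * h) <= len g + len h)%N.
Proof.
case: (len_word g) => s <- <-; case: (len_word h) => t <- <-.
by rewrite -prd_cat -size_cat len_prd.
Qed.

Lemma lenV g : len g^-1 = len g.
Proof.
suff le h : (len h^-1 <= len h)%N by apply/eqP; rewrite eqn_leq le -{1}[g]invgK le.
by case: (len_word h) => s <- <-; rewrite (prdV cox) -size_rev len_prd.
Qed.

Lemma len_mulgen g (v : V) : (len (g * val v) <= (len g).+1)%N.
Proof.
rewrite -addn1; apply: leq_trans (lenM _ _) _; rewrite leq_add2l.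
by have := len_prd [:: v]; rewrite prd_cons prd_nil mulg1.
Qed.

(** If [v] is an inversion, then the letter at which the sign changes can be
    deleted; and one of the elements [g] and [g v] has [v] as an inversion, so
    that inversions are exactly what makes the length drop. *)
Lemma len_exchange (s : seq V) (v : V) : (len (prd s * val v) <= len (prd s))%N ->
  exists s1 a s2, s = s1 ++ a :: s2 /\ prd s * val v = prd (s1 ++ s2).
Proof.
have [inv [invM invv]] := coxeter_cocycle cox.
have del t r : inv (prd t) r ->
    exists s1 a s2, t = s1 ++ a :: s2 /\ prd t * r = prd (s1 ++ s2).
  elim: t => [|a t IH].
    have inv1 : inv 1 r = false.
      have := invM 1 1 r; rewrite mulg1 mul1g invg1 mulg1.
      by case: (inv 1 r).
    by rewrite prd_nil inv1.
  rewrite prd_cons invM invv; case: (boolP (inv (prd t) r)) => [/IH|_ /eqP ha].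
    case=> s1 [b [s2 [-> e]]] _; exists (a :: s1), b, s2.
    by rewrite -mulgA e -prd_cons.
  exists [::], a, t; split=> //=.
  have e : prd t * r = val a * prd t by rewrite -ha mulgVK.
  by rewrite -mulgA e (genKmul cox).
move=> le; apply: (del); case: (boolP (inv (prd s) (val v))) => // nv.
have : inv (prd s * val v) (val v).
  rewrite invM invv eqxx /= mulgK.
  by rewrite (negbTE nv).
case: (len_word (prd s * val v)) => t te ts; rewrite -te => /del.
case=> s1 [a [s2 [tE]]]; rewrite te (mulgenK cox) => sE.
have : (len (prd s) <= size (s1 ++ s2))%N by rewrite sE len_prd.
move: ts le; rewrite tE !size_cat /=; lia.
Qed.

(** The relators have even length, so the length has a well-defined parity. *)
Lemma len_neq g (v : V) : len (g * val v) != len g.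
Proof.
have [sgn [sgnM sgnv]] := coxeter_sign cox.
have sgn_prd s : sgn (prd s) = odd (size s).
  elim: s => [|a s IH]; last by rewrite prd_cons sgnM sgnv IH.
  by have := sgnM 1 1; rewrite mulg1 prd_nil; case: (sgn 1).
have sgnE h : sgn h = odd (len h).
  by case: (len_word h) => s <- <-; rewrite sgn_prd.
have := sgnM g (val v); rewrite sgnv !sgnE.
by case: eqP => // ->; case: odd.
Qed.

Definition descent (g : G) (v : V) : bool := (len (g * val v) < len g)%N.

Lemma len_descent g v : descent g v -> len g = (len (g * val v)).+1.
Proof.
rewrite /descent => lt; apply/eqP; rewrite eqn_leq lt andbT.
by rewrite -{1}(mulgenK cox v g) len_mulgen.
Qed.

Lemma len_ascent g v : ~~ descent g v -> len (g * val v) = (len g).+1.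
Proof.
rewrite /descent -leqNgt leq_eqVlt eq_sym (negbTE (len_neq _ _)) /= => lt.
by apply/eqP; rewrite eqn_leq lt len_mulgen.
Qed.

Lemma descent1 v : descent 1 v = false.
Proof. by rewrite /descent len1. Qed.

Lemma descent_mul g v : descent (g * val v) v = ~~ descent g v.
Proof.
rewrite {1}/descent (mulgenK cox); case: (boolP (descent g v)) => [/len_descent ->|/len_ascent ->].
  by rewrite ltnNge leqW.
by rewrite ltnSn.
Qed.

Definition parabolic (T : set V) : set G :=
  [set g | exists2 s : seq V, prd s = g & forall v, v \in s -> T v].

Lemma parabolic1 T : parabolic T 1.
Proof. by exists [::]; rewrite ?prd_nil. Qed.

Lemma parabolicM T g h : parabolic T g -> parabolic T h -> parabolic T (g * h).
Proof.
move=> [s <- Ts] [t <- Tt]; exists (s ++ t); rewrite ?prd_cat// => v.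
by rewrite mem_cat => /orP[/Ts|/Tt].
Qed.

Lemma parabolicV T g : parabolic T g -> parabolic T g^-1.
Proof.
move=> [s <- Ts]; exists (rev s); first by rewrite (prdV cox).
by move=> v; rewrite mem_rev; apply: Ts.
Qed.

Lemma parabolic_gen (T : set V) v : T v -> parabolic T (val v).
Proof.
by move=> Tv; exists [:: v]; rewrite ?prd_cons ?prd_nil ?mulg1// => w; rewrite inE => /eqP ->.
Qed.

(** A word is made reduced by the exchange condition, which only deletes letters
    and therefore does not leave [T]. *)
Lemma parabolic_reduced (T : set V) g : parabolic T g ->
  exists2 s : seq V, prd s = g &
    size s = len g /\ forall v, v \in s -> T v.
Proof.
case=> s <-; elim/last_ind: s => [_|s v IH Ts].
  by exists [::]; rewrite ?prd_nil ?len1.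
have {IH}[|t te [ts tT]] := IH.
  by move=> w ws; apply: Ts; rewrite mem_rcons inE ws orbT.
rewrite prd_rcons -te; case: (boolP (descent (prd t) v)) => [d|/len_ascent e].
  have [s1 [a [s2 [tE e]]]] := len_exchange (ltnW d).
  exists (s1 ++ s2) => //; split.
    apply/eqP; rewrite -eqSS -(len_descent d) te -ts tE !size_cat addnS//.
  move=> w ws; apply: tT; move: ws; rewrite tE !mem_cat inE.
  by case/orP=> ->; rewrite ?orbT.
exists (rcons t v); first by rewrite prd_rcons.
split; first by rewrite size_rcons ts e te.
by move=> w; rewrite mem_rcons inE => /orP[/eqP ->|/tT//]; apply: Ts; rewrite mem_rcons mem_head.
Qed.

Lemma parabolic_mulgen (T : set V) g v : T v ->
  `[< parabolic T (g * val v) >] = `[< parabolic T g >].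
Proof.
move=> /parabolic_gen Tv; apply/asboolP/asboolP => p; last exact: parabolicM.
by rewrite -[g](mulgenK cox v); apply: parabolicM.
Qed.

Lemma parabolic_descent (T : set V) g : parabolic T g -> g <> 1 ->
  exists2 v, T v & descent g v.
Proof.
move=> /parabolic_reduced[q qg [ql qT]] g1.
case/lastP: q => [|q v] in qg ql qT *; first by case: g1; rewrite -qg prd_nil.
exists v; first by apply: qT; rewrite mem_rcons mem_head.
rewrite /descent -qg prd_rcons (mulgenK cox) -prd_rcons qg -ql size_rcons ltnS.
exact: len_prd.
Qed.

Lemma exists_descent g : g <> 1 -> exists v, descent g v.
Proof.
have [s <-] := word_of cox g.
have p : parabolic [set: V] (prd s) by exists s.
by move=> /(parabolic_descent p)[v _ d]; exists v.
Qed.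

(** Let [s] be a reduced word in [T].  By induction [w] has a reduced expression
    [X s].  If [s r] is still reduced then the exchange condition for [w] and [r]
    deletes a letter of [X], since a deletion inside [s] would shorten [s r].
    So every element of the subgroup is a right factor of [w]. *)
Lemma len_longest (T : set V) w u : (forall v, T v -> descent w v) ->
  parabolic T u -> (len (w * u) + len u = len w)%N.
Proof.
move=> Tw /parabolicV; rewrite -(lenV u) -{2}[u]invgK.
move: u^-1 => {}u /parabolic_reduced [s <- [ss Ts]].
elim/last_ind: s ss Ts => [|s r IH] ss Ts.
  by rewrite prd_nil invg1 mulg1 len1 addn0.
have ss' : size s = len (prd s).
  apply/eqP; rewrite eqn_leq len_prd andbT -ltnS -(size_rcons s r) ss prd_rcons.
  exact: len_mulgen.
have {}IH : (len (w * (prd s)^-1) + size s = len w)%N.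
  rewrite ss'; apply: IH => // v vs; apply: (Ts).
  by rewrite mem_rcons inE vs orbT.
have Tr : T r by apply: (Ts); rewrite mem_rcons mem_head.
case: (len_word (w * (prd s)^-1)) => X Xe Xs.
have wE : w = prd (X ++ s) by rewrite prd_cat Xe mulgVK.
have ge : (len w <= len (w * (prd (rcons s r))^-1) + size (rcons s r))%N.
  rewrite ss; apply: leq_trans (lenM _ _).
  by rewrite mulgVK.
rewrite -ss; apply/eqP; rewrite eqn_leq ge andbT size_rcons prd_rcons invgM (genV cox) mulgA.
have [] := @len_exchange (X ++ s) r; first by rewrite -wE; apply: ltnW; apply: (Tw).
move=> s1 [a [s2 [e1 e2]]].
have wr : w * val r * (prd s)^-1 = prd (s1 ++ s2) * (prd s)^-1 by rewrite -e2 -wE.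
case: (cat_split_letter e1) => [[X1 [X2 [XE sE]]]|[t1 [t2 [sE tE]]]].
  have le : (len (w * val r * (prd s)^-1) <= size (X1 ++ X2))%N.
    by rewrite wr sE catA prd_cat mulgK len_prd.
  by move: le; rewrite -IH -Xs XE !size_cat [size (a :: X2)]/= !addnS addSn ltnS leq_add2r.
have : prd s * val r = prd (t1 ++ t2).
  by apply: (mulgI (prd X)); rewrite -prd_cat -tE -e2 prd_cat mulgA.
move/(congr1 len); rewrite -prd_rcons -ss size_rcons => e.
have := len_prd (t1 ++ t2); rewrite -e sE !size_cat /=; lia.
Qed.

End Length.


Local Close Scope group_scope.
Local Open Scope ring_scope.

(** * Finite sums *)

Section FiniteSums.
Variables (I : choiceType) (A : zmodType).
Implicit Types F : I -> A.

Definition fin_supp F := finite_set [set i | F i != 0].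

Lemma fin_suppP F : fin_supp F <-> exists2 r : seq I, uniq r & forall i, F i != 0 -> i \in r.
Proof.
split=> [|[r _ rF]].
  move=> /finite_seqP[r rE]; exists (undup r); first exact: undup_uniq.
  move=> i Fi; rewrite mem_undup; have : [set i | F i != 0] i by [].
  by rewrite rE.
by apply: (@sub_finite_set _ _ [set` r]) => [i /rF|]//; exact: finite_seq.
Qed.

Definition fsum F : A := \sum_(i \in setT) F i.

Lemma fsumE F (r : seq I) : uniq r -> (forall i, F i != 0 -> i \in r) ->
  fsum F = \sum_(i <- r) F i.
Proof.
move=> ur rF; rewrite /fsum (fsbigE r)//; first by apply: eq_bigl => i; rewrite in_setT.
by move=> i _ ir; apply/eqP; apply: contraNT ir; apply: rF.
Qed.

Lemma fsum0 F : (forall i, F i = 0) -> fsum F = 0.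
Proof. by move=> F0; rewrite (@fsumE _ [::]) ?big_nil// => i; rewrite F0 eqxx. Qed.

Lemma fsum1 F i0 : (forall i, i != i0 -> F i = 0) -> fsum F = F i0.
Proof.
move=> F0; rewrite (@fsumE _ [:: i0]) ?big_seq1// => i Fi.
by rewrite inE; apply: contraNT Fi => /F0 ->.
Qed.

Lemma eq_fsum F F' : F =1 F' -> fsum F = fsum F'.
Proof. by move=> /funext ->. Qed.

Lemma fin_supp_common F F' : fin_supp F -> fin_supp F' ->
  exists2 r, uniq r & forall i, (F i != 0) || (F' i != 0) -> i \in r.
Proof.
move=> /fin_suppP[r1 _ h1] /fin_suppP[r2 _ h2]; exists (undup (r1 ++ r2)).
  exact: undup_uniq.
by move=> i; rewrite mem_undup mem_cat => /orP[/h1|/h2] ->; rewrite ?orbT.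
Qed.

Lemma fin_suppB F F' : fin_supp F -> fin_supp F' -> fin_supp (fun i => F i - F' i).
Proof.
move=> f1 f2; have [r ur h] := fin_supp_common f1 f2; apply/fin_suppP; exists r => // i.
move=> nz; apply: h; apply: contraNT nz; rewrite negb_or !negbK.
by move=> /andP[/eqP -> /eqP ->]; rewrite subr0.
Qed.

Lemma fsumB F F' : fin_supp F -> fin_supp F' ->
  fsum (fun i => F i - F' i) = fsum F - fsum F'.
Proof.
move=> f1 f2; have [r ur h] := fin_supp_common f1 f2.
rewrite !(@fsumE _ r)// ?sumrB// => i nz; apply: h; rewrite ?nz ?orbT//.
apply: contraNT nz; rewrite negb_or !negbK.
by move=> /andP[/eqP -> /eqP ->]; rewrite subr0.
Qed.

Lemma fsum_reindex F (h h' : I -> I) : cancel h h' -> cancel h' h ->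
  fsum (fun i => F (h i)) = fsum F.
Proof.
move=> hK h'K; rewrite /fsum; apply: esym; apply: reindex_fsbigT.
by exists h'.
Qed.

End FiniteSums.

Lemma fin_supp_inj (I J : choiceType) (A : zmodType) (F : I -> A) (h : J -> I) (h' : I -> J) :
  cancel h h' -> fin_supp F -> fin_supp (fun j => F (h j)).
Proof.
move=> hK /fin_suppP[r _ rF]; apply/fin_suppP; exists (undup (map h' r)).
  exact: undup_uniq.
by move=> j /rF jr; rewrite mem_undup; apply/mapP; exists (h j).
Qed.

Lemma fsum_morph (I : choiceType) (A B : zmodType) (g : {additive A -> B}) (F : I -> A) :
  fin_supp F -> g (fsum F) = fsum (fun i => g (F i)).
Proof.
move=> /fin_suppP[r ur rF]; rewrite !(@fsumE _ _ _ r)// ?raddf_sum// => i nz.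
by apply: rF; apply: contraNneq nz => ->; rewrite raddf0.
Qed.

(** * Coloured simplices *)

Section Simplices.
Variables (n : nat) (X : choiceType).

(** A set of vertices with at most one vertex of each colour.  The order of the
    colours provides the orientation. *)
Definition csimplex := {ffun 'I_n -> option X}.
Implicit Types (t : csimplex) (i j : 'I_n).

Definition empty_simplex : csimplex := [ffun=> None].

Definition upd t i (o : option X) : csimplex := [ffun j => if j == i then o else t j].

Lemma updE t i o : upd t i o i = o. Proof. by rewrite ffunE eqxx. Qed.

Lemma upd_neq t i o j : j != i -> upd t i o j = t j.
Proof. by rewrite ffunE => /negbTE ->. Qed.

Lemma upd_id t i : upd t i (t i) = t.
Proof. by apply/ffunP => j; rewrite !ffunE; case: eqP => // ->. Qed.

Lemma upd_upd t i o o' : upd (upd t i o) i o' = upd t i o'.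
Proof. by apply/ffunP => j; rewrite !ffunE; case: eqP. Qed.

Lemma upd_comm t i j o o' : i != j -> upd (upd t i o) j o' = upd (upd t j o') i o.
Proof.
move=> ij; apply/ffunP => k; rewrite !ffunE; have [->|//] := eqVneq k j.
by rewrite eq_sym (negbTE ij).
Qed.

Definition card_simplex t : nat := \sum_(i < n) (t i != None).

Lemma card_upd t i x : t i = None -> card_simplex (upd t i (Some x)) = (card_simplex t).+1.
Proof.
move=> ti; rewrite /card_simplex (bigD1 i)//= [in RHS](bigD1 i)//= updE ti /= add1n add0n.
by congr _.+1; apply: eq_bigr => j ji; rewrite upd_neq.
Qed.

Lemma card_simplex_le t : (card_simplex t <= n)%N.
Proof.
rewrite -[X in (_ <= X)%N]card_ord -sum1_card; apply: leq_sum => i _.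
exact: leq_b1.
Qed.

Lemma empty_card : card_simplex empty_simplex = 0%N.
Proof. by rewrite /card_simplex big1// => i _; rewrite ffunE. Qed.

(** The number of vertices before colour [i] gives the sign of the face that omits it. *)
Definition sg t i : int := (-1) ^+ (\sum_(j < n | (j < i)%N) (t j != None)).

Lemma sgK t i : sg t i * sg t i = 1.
Proof. by rewrite /sg -expr2 sqrr_sign. Qed.

Lemma sg_upd t i j x : t i = None -> sg (upd t i (Some x)) j = sg t j * (-1) ^+ (i < j)%N.
Proof.
move=> ti; rewrite /sg -exprD; congr (_ ^+ _).
have [ij|ij] := boolP (i < j)%N.
  rewrite (bigD1 i)//= [in RHS](bigD1 i)//= updE ti /= add0n addnC; congr addn.
  by apply: eq_bigr => k /andP[_ ki]; rewrite upd_neq.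
rewrite addn0; apply: eq_bigr => k kj; rewrite upd_neq//.
by apply: contraNneq ij => <-.
Qed.

Lemma sg_self t i o : sg (upd t i o) i = sg t i.
Proof.
rewrite /sg; congr (_ ^+ _); apply: eq_bigr => j ji; rewrite upd_neq//.
by apply: contraTneq ji => ->; rewrite ltnn.
Qed.

Lemma sg_anti t i j x y : i != j -> t i = None -> t j = None ->
  sg t i * sg (upd t i (Some x)) j = - (sg t j * sg (upd t j (Some y)) i).
Proof.
move=> ij ti tj; rewrite !sg_upd// mulrCA -mulrN; congr (_ * _).
rewrite -mulrN; congr (_ * _).
by case: (ltngtP i j) ij => [||/val_inj ->]; rewrite ?eqxx ?expr1 ?expr0 ?opprK.
Qed.

Lemma sg_anti' t i j x y : i != j -> t i = None -> t j = None ->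
  sg (upd t i (Some x)) j * sg (upd t j (Some y)) i = - (sg t i * sg t j).
Proof.
move=> ij ti tj; rewrite !sg_upd//.
case: (ltngtP i j) ij => [||/val_inj ->]; rewrite ?eqxx ?expr1 ?expr0 => // _ _; ring.
Qed.

End Simplices.

(** * The complex of anti-invariants *)

Section Complex.
Variables (G : groupType) (V : set G) (m : V -> V -> option nat).
Hypothesis cox : coxeter_system m.
Variables (n : nat) (f : V -> 'I_n).
Hypothesis f_inj : forall s t, s <> t -> finite_set (parabolic [set s; t]) -> f s <> f t.

Local Notation F := (csimplex n V).
Local Notation len := (len cox).
Local Notation descent := (descent cox).
Implicit Types (t : F) (w : G) (x y : G * F -> int).

Definition vert t : set V := [set v | exists i, t i = Some v].

(** The sum of the anti-invariant ideals [A_T] over the sets [T] of [k] vertices: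
    a chain is seen as a function of a group element and of a set [T].  Finite
    support makes it vanish on the sets [T] that generate an infinite subgroup. *)
Record chain (k : nat) (x : G * F -> int) : Prop := Chain {
  chain_fin : fin_supp x;
  chain_card : forall w t, x (w, t) != 0 -> card_simplex t = k;
  chain_color : forall w t i v, x (w, t) != 0 -> t i = Some v -> f v = i;
  chain_anti : forall w t i v, t i = Some v -> x ((w * val v)%g, t) = - x (w, t) }.

Lemma chainB k x y : chain k x -> chain k y -> chain k (x - y).
Proof.
move=> [x1 x2 x3 x4] [y1 y2 y3 y4].
have nz p : (x - y) p != 0 -> (x p != 0) || (y p != 0).
  apply: contraR; rewrite negb_or !negbK => /andP[/eqP e1 /eqP e2].
  by rewrite -[(x - y) p]/(x p - y p) e1 e2 subrr.
split.
- exact: fin_suppB.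
- by move=> w t /nz/orP[/x2|/y2].
- by move=> w t i v /nz/orP[/x3|/y3]; apply.
- move=> w t i v tv; have E p : (x - y) p = x p - y p by [].
  by rewrite !E (x4 _ _ _ _ tv) (y4 _ _ _ _ tv) opprB opprK addrC.
Qed.

Lemma chain0 k : chain k 0.
Proof.
split=> //.
by apply/fin_suppP; exists [::].
Qed.

Definition bd_term x (w : G) t (v : V) : int :=
  if t (f v) == None then sg t (f v) * x (w, upd t (f v) (Some v)) else 0.

Definition bd x : G * F -> int := fun p => fsum (bd_term x p.1 p.2).

Definition aug x : int := fsum (fun w => x (w, empty_simplex n V)).

Lemma chain_verts x : fin_supp x ->
  exists2 r : seq V, uniq r & forall w t i v, x (w, t) != 0 -> t i = Some v -> v \in r.
Proof.
move=> /fin_suppP[r _ rx].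
exists (undup (flatten [seq pmap (fun i => (p : G * F).2 i) (enum 'I_n) | p : G * F <- r])); first exact: undup_uniq.
move=> w t i v /rx wr ti; rewrite mem_undup; apply/flattenP.
exists (pmap t (enum 'I_n)); first by apply/mapP; exists (w, t).
by rewrite mem_pmap; apply/mapP; exists i; rewrite ?mem_enum.
Qed.

Lemma bd_term_vert x w t v : bd_term x w t v != 0 ->
  t (f v) = None /\ x (w, upd t (f v) (Some v)) != 0.
Proof.
rewrite /bd_term; case: (t (f v) =P None) => // tv nz; split=> //.
by apply: contraNneq nz => ->; rewrite mulr0.
Qed.

Lemma bd_termE x (r : seq V) w t : uniq r ->
  (forall w t i v, x (w, t) != 0 -> t i = Some v -> v \in r) ->
  bd x (w, t) = \sum_(v <- r) bd_term x w t v.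
Proof.
move=> ur rx; apply: fsumE => // v /bd_term_vert[_ xv].
by apply: (rx _ _ (f v) v xv); rewrite updE.
Qed.

Lemma bd_term_fin x w t : fin_supp x -> fin_supp (bd_term x w t).
Proof.
move=> /chain_verts[r ur rx]; apply/fin_suppP; exists r => // v /bd_term_vert[_ xv].
by apply: (rx _ _ (f v) v xv); rewrite updE.
Qed.

Lemma bdB k x y : chain k x -> chain k y -> bd (x - y) = bd x - bd y.
Proof.
move=> cx cy; apply/funext => -[w t].
rewrite -[RHS]/(fsum _ - fsum _) -fsumB; try exact: bd_term_fin (chain_fin cx); last exact: bd_term_fin (chain_fin cy).
apply: eq_fsum => v; rewrite /bd_term; case: (t (f v) =P None) => _; last by rewrite subr0.
by rewrite -mulrBr.
Qed.

Lemma bd_supp x w t : bd x (w, t) != 0 ->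
  exists v, t (f v) = None /\ x (w, upd t (f v) (Some v)) != 0.
Proof.
move=> nz; apply: contrapT => h; case/negP: nz; apply/eqP/fsum0 => v.
by apply/eqP; apply: contrapT => /negP/bd_term_vert xv; apply: h; exists v.
Qed.

Lemma chain_bd k x : chain k.+1 x -> chain k (bd x).
Proof.
case=> fx cx colx ax; split.
- apply: (@sub_finite_set _ _
    ((fun q : (G * F) * 'I_n => (q.1.1, upd q.1.2 q.2 None)) @`
     ([set p | x p != 0] `*` [set: 'I_n]))).
    move=> [w t] /= /bd_supp[v [tv xv]].
    exists ((w, upd t (f v) (Some v)), f v) => //=.
    by rewrite upd_upd -tv upd_id.
  apply: finite_image; apply: finite_setX => //.
- by move=> w t /bd_supp[v [tv /cx]]; rewrite card_upd// => -[].
- move=> w t i v /bd_supp[u [tu xu]] ti; apply: colx xu _.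
  by rewrite upd_neq//; apply/eqP => e; move: ti; rewrite e tu.
- have [r ur rx] := chain_verts fx.
  move=> w t i v ti; rewrite !(bd_termE _ _ ur rx) -sumrN; apply: eq_bigr => u _.
  rewrite /bd_term; case: (t (f u) =P None) => [tu|_]; last by rewrite oppr0.
  rewrite (ax _ _ i v) ?mulrN// upd_neq//.
  by apply/eqP => e; move: ti; rewrite e tu.
Qed.

(** The terms that add the vertices [u] and [v] in both orders cancel. *)
Lemma bd_bd x : fin_supp x -> bd (bd x) = 0.
Proof.
move=> fx; apply/funext => -[w t]; rewrite -[RHS]/(0 : int).
have [r ur rx] := chain_verts fx.
have rbd w' t' i v : bd x (w', t') != 0 -> t' i = Some v -> v \in r.
  move=> /bd_supp[u [tu xu]] ti; apply: (rx _ _ i v xu).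
  by rewrite upd_neq//; apply/eqP => e; move: ti; rewrite e tu.
rewrite (bd_termE _ _ ur rbd).
pose T u v : int := if (t (f u) == None) && (t (f v) == None) && (f u != f v) then
  sg t (f u) * sg (upd t (f u) (Some u)) (f v)
    * x (w, upd (upd t (f u) (Some u)) (f v) (Some v)) else 0.
have TE u : bd_term (bd x) w t u = \sum_(v <- r) T u v.
  rewrite /bd_term /T; case: (t (f u) =P None) => tu /=; last by rewrite big1.
  rewrite (bd_termE _ _ ur rx) mulr_sumr; apply: eq_bigr => v _.
  rewrite /bd_term; have [<-|uv] := eqVneq (f u) (f v).
    by rewrite updE mulr0 andbF.
  rewrite (upd_neq t (Some u) (i := f u)) 1?[_ == f u]eq_sym// andbT.
  case: (t (f v) =P None) => _ /=; last by rewrite mulr0.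
  by rewrite mulrA.
have Tanti u v : T u v = - T v u.
  rewrite /T [f v == f u]eq_sym [(t (f v) == _) && _]andbC.
  case: ifP => [/andP[/andP[/eqP tu /eqP tv] uv]|_]; last by rewrite oppr0.
  rewrite (@sg_anti _ _ t _ _ u v uv)// mulNr; congr (- (_ * x (w, _))).
  exact: upd_comm.
rewrite (eq_bigr _ (fun u _ => TE u)).
set S := (X in X = _).
have : S = - S.
  rewrite {1}/S exchange_big /S -sumrN; apply: eq_bigr => u _.
  by rewrite -sumrN; apply: eq_bigr => v _; rewrite -Tanti.
lia.
Qed.

(** The values of an anti-invariant element at [w] and at [w v] cancel. *)
Lemma aug_bd x : chain 1 x -> aug (bd x) = 0.
Proof.
case=> fx cx colx ax; have [r ur rx] := chain_verts fx.
pose e := empty_simplex n V.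
have bdE w : bd x (w, e) = \sum_(v <- r) x (w, upd e (f v) (Some v)).
  rewrite (bd_termE _ _ ur rx); apply: eq_bigr => v _.
  rewrite /bd_term {1}/e ffunE eqxx /sg big1 ?expr0 ?mul1r// => j _.
  by rewrite ffunE.
have fs v : fin_supp (fun w => x (w, upd e (f v) (Some v))).
  have [q _ qx] := (fin_suppP x).1 fx; apply/fin_suppP.
  exists (undup (map fst q)); first exact: undup_uniq.
  by move=> w /qx wq; rewrite mem_undup; apply/mapP; exists (w, upd e (f v) (Some v)).
have z v : fsum (fun w => x (w, upd e (f v) (Some v))) = 0.
  have SE : fsum (fun w => x (w, upd e (f v) (Some v))) =
            fsum (fun w => x ((w * val v)%g, upd e (f v) (Some v))).
    apply/esym/(@fsum_reindex _ _ (fun w => x (w, _)) (fun w => (w * val v)%g)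
      (fun w => (w * val v)%g)) => w; exact: (mulgenK cox).
  set S := fsum _; have : S = - S.
    rewrite {1}/S SE -sub0r -[X in X - _](@fsum0 _ _ (fun w : G => 0 : int))// -fsumB//.
      by apply: eq_fsum => w; rewrite (ax _ _ (f v) v) ?updE ?sub0r.
    by apply/fin_suppP; exists [::] => // i; rewrite eqxx.
  lia.
rewrite /aug (eq_fsum bdE).
have [q uq qx] := (fin_suppP x).1 fx.
rewrite (@fsumE _ _ _ (undup (map fst q))) ?undup_uniq//; last first.
  move=> w nz; rewrite mem_undup.
  have [v xv] : exists v, x (w, upd e (f v) (Some v)) != 0.
    apply: contrapT => h; case/negP: nz; apply/eqP; rewrite big1// => v _.
    by apply/eqP/negPn/negP => xv; apply: h; exists v.
  by apply/mapP; exists (w, upd e (f v) (Some v)) => //; apply: qx.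
rewrite exchange_big big1// => v _; rewrite -[RHS](z v); apply: esym; apply: fsumE.
  exact: undup_uniq.
by move=> w xw; rewrite mem_undup; apply/mapP; exists (w, upd e (f v) (Some v)) => //; apply: qx.
Qed.

(** By [len_longest] the lengths are bounded by that of [w]. *)
Lemma parabolic_finite (T : set V) w : finite_set T ->
  (forall v, T v -> descent w v) -> finite_set (parabolic T).
Proof.
move=> finT Tw.
pose B k := [set g | exists2 s : seq V, prd s = g & (size s <= k)%N /\ forall v, v \in s -> T v].
have finB k : finite_set (B k).
  elim: k => [|k IH].
    apply: (@sub_finite_set _ _ [set 1%g]) => // g [s <-].
    by rewrite leqn0 => -[/nilP -> _]; rewrite prd_nil.
  apply: (@sub_finite_set _ _ ([set 1%g] `|` (fun p => (val p.1 * p.2)%g) @` (T `*` B k))).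
    move=> g [[|v s] <- [sk Ts]]; first by left; rewrite prd_nil.
    right; exists (v, prd s); rewrite ?prd_cons//; split=> /=; first exact/Ts/mem_head.
    by exists s => //; split=> // u us; apply: Ts; rewrite inE us orbT.
  by rewrite finite_setU; split=> //; apply/finite_image/finite_setX.
apply: sub_finite_set (finB (len w)) => u Tu.
have [s su [sl sT]] := parabolic_reduced cox Tu.
by exists s => //; split=> //; rewrite sl -(len_longest Tw Tu) leq_addl.
Qed.

(** Two descents of [w] generate a finite subgroup. *)
Lemma descent_color_inj w (u v : V) : descent w u -> descent w v -> f u = f v -> u = v.
Proof.
move=> wu wv fuv; apply: contrapT => uv; apply: (f_inj uv) fuv.
by apply: (@parabolic_finite _ w) => // _ [->|->].
Qed.

Lemma vert_finite t : finite_set (vert t).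
Proof.
apply: (@sub_finite_set _ _ [set` pmap (fun i => t i) (enum 'I_n)]).
  by move=> v [i ti] /=; rewrite mem_pmap; apply/mapP; exists i; rewrite ?mem_enum.
exact: finite_seq.
Qed.

Lemma top_descent k x w t v : chain k x ->
  (forall w' t', x (w', t') != 0 -> (len w' <= len w)%N) ->
  x (w, t) != 0 -> vert t v -> descent w v.
Proof.
move=> cx top xw [i ti]; apply/negPn/negP => /len_ascent e.
have : (len (w * val v) <= len w)%N.
  by apply: (top _ t); rewrite (chain_anti cx _ ti) oppr_eq0.
by rewrite e ltnn.
Qed.

(** The cone with apex a descent [s] of [w] contracts the simplex of the descents
    of [w].  Each of its faces [T] is spread over the coset of [w] with
    alternating signs, to make it anti-invariant; the other elements of that
    coset are shorter than [w]. *)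
Lemma cone_step k x w : chain k x -> w <> 1%g -> (forall t, bd x (w, t) = 0) ->
  (forall w' t, x (w', t) != 0 -> (len w' <= len w)%N) ->
  exists y, [/\ chain k.+1 y, forall t, bd y (w, t) = x (w, t)
    & forall w' t, y (w', t) != 0 -> w' = w \/ (len w' < len w)%N].
Proof.
move=> cx w1 cyc top.
have [sgn [sgnM sgnv]] := coxeter_sign cox.
have sgn1 : sgn 1%g = false by have := sgnM 1%g 1%g; rewrite mulg1; case: (sgn 1%g).
have [s ws] := exists_descent cox w1.
pose yw t : int := if t (f s) == Some s then sg t (f s) * x (w, upd t (f s) None) else 0.
pose y (p : G * F) : int := if `[< parabolic (vert p.2) (w^-1 * p.1)%g >]
  then (-1) ^+ (sgn (w^-1 * p.1)%g) * yw p.2 else 0.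
have yw_supp t : yw t != 0 -> [/\ t (f s) = Some s,
    x (w, upd t (f s) None) != 0 & forall v, vert t v -> descent w v].
  rewrite /yw; case: (t (f s) =P Some s) => [ts|]; last by rewrite eqxx.
  move=> nz; have xw : x (w, upd t (f s) None) != 0.
    by apply: contraNneq nz => ->; rewrite mulr0.
  split=> // v [i ti]; have [e|ne] := eqVneq i (f s).
    by move: ti; rewrite e ts => -[<-].
  by apply: (top_descent cx top xw); exists i; rewrite upd_neq.
have y_supp w' t : y (w', t) != 0 -> parabolic (vert t) (w^-1 * w')%g /\ yw t != 0.
  rewrite /y /=; case: asboolP => [p|_]; last by rewrite eqxx.
  by move=> nz; split=> //; apply: contraNneq nz => ->; rewrite mulr0.
have yE t : y (w, t) = yw t.
  rewrite /y /= mulVg sgn1 expr0 mul1r; case: asboolP => // -[].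
  exact: parabolic1.
exists y; split.
- split.
  + pose S := [set t | x (w, upd t (f s) None) != 0 /\ t (f s) = Some s].
    have finS : finite_set (S `&` [set t | yw t != 0]).
      apply: (@sub_finite_set _ _ ((fun p => upd p.2 (f s) (Some s)) @` [set p | x p != 0])).
        move=> t [[xt ts] _]; exists (w, upd t (f s) None) => //=.
        by rewrite upd_upd -ts upd_id.
      exact/finite_image/(chain_fin cx).
    apply: (@sub_finite_set _ _ (\bigcup_(t in S `&` [set t | yw t != 0])
       ((fun u => ((w * u)%g, t)) @` parabolic (vert t)))).
      move=> [w' t] /= /y_supp[p ny]; have [ts xt _] := yw_supp _ ny.
      by exists t => //; exists (w^-1 * w')%g; rewrite ?mulVKg.
    apply: bigcup_finite => // t [_ /yw_supp[_ _ h]]; apply: finite_image.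
    exact: (parabolic_finite (vert_finite t) h).
  + move=> w' t /y_supp[_ /yw_supp[ts xt _]].
    rewrite -[t](upd_id t (f s)) ts -(upd_upd t (f s) None) card_upd ?updE//.
    by rewrite (chain_card cx xt).
  + move=> w' t i v /y_supp[_ /yw_supp[ts xt _]] ti.
    have [e|ne] := eqVneq i (f s); first by move: ti; rewrite e ts => -[<-].
    by apply: (chain_color cx xt); rewrite upd_neq.
  + move=> w' t i v ti; rewrite /y /= mulgA.
    rewrite (parabolic_mulgen cox); last by exists i.
    case: ifP => _; last by rewrite oppr0.
    by rewrite sgnM sgnv addbT; case: (sgn _); rewrite ?expr0 ?expr1 ?mulN1r ?mul1r ?opprK.
- move=> t; rewrite /bd /=.
  have [ts|ts] := eqVneq (t (f s)) None.
    rewrite (@fsum1 _ _ _ s) => [|u us].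
      rewrite /bd_term ts eqxx yE /yw updE eqxx sg_self mulrA sgK mul1r.
      by rewrite upd_upd -ts upd_id.
    rewrite /bd_term yE /yw; case: (t (f u) =P None) => // _.
    have [e|ne] := eqVneq (f s) (f u).
      rewrite e updE; case: (Some u =P Some s) => [[uE]|_]; last by rewrite mulr0.
      by rewrite uE eqxx in us.
    by rewrite upd_neq// ts /= mulr0.
  have [{}ts|ts'] := eqVneq (t (f s)) (Some s); last first.
    rewrite fsum0 => [|u]; last first.
      rewrite /bd_term yE /yw; case: (t (f u) =P None) => // tu.
      rewrite upd_neq ?(negbTE ts') ?mulr0//.
      by apply: contraNneq ts => ->; rewrite tu.
    case tE : (t (f s)) ts ts' => [u|//] _ us; apply: esym; apply/eqP.
    apply: contraNT us => xw; apply/eqP; congr Some.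
    apply: (@descent_color_inj w) => //; last exact: (chain_color cx xw tE).
    by apply: (top_descent cx top xw); exists (f s).
  (* Here the cycle condition is used, at the face opposite to [s]. *)
  set i := f s in ts *; pose t' := upd t i None.
  have tE : t = upd t' i (Some s) by rewrite upd_upd -ts upd_id.
  have E u : bd_term y w t u =
      (if u == s then x (w, t) else 0) - sg t' i * bd_term x w t' u.
    rewrite /bd_term yE /yw -/i; have [->|us] := eqVneq u s.
      by rewrite -/i ts /= updE eqxx mulrA sgK mul1r -tE subrr.
    rewrite sub0r; have [e|ne] := eqVneq (f u) i.
      rewrite e ts /= updE eqxx; have [->|xw] := eqVneq (x (w, upd t' i (Some u))) 0.
        by rewrite !mulr0 oppr0.
      case/negP: us; apply/eqP/(@descent_color_inj w) => //.
      by apply: (top_descent cx top xw); exists i; rewrite updE.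
    have ne' : i != f u by rewrite eq_sym.
    rewrite (upd_neq t _ ne') ts eqxx (upd_neq t _ ne).
    case: (t (f u) =P None) => tu; last by rewrite mulr0 oppr0.
    rewrite mulrA {1 2}tE (upd_comm _ _ _ ne') sg_self.
    rewrite (sg_anti' (t := t') s u ne') ?updE ?upd_neq// mulNr mulrA; congr (- (_ * x (w, _))).
    by rewrite {1}tE upd_comm// upd_upd /t' upd_comm// upd_upd.
  have fs := bd_term_fin w t' (chain_fin cx).
  rewrite (eq_fsum E) fsumB.
  + rewrite (@fsum1 _ _ _ s) => [|u /negbTE -> //]; rewrite eqxx.
    have -> : fsum (fun u => sg t' i * bd_term x w t' u) = sg t' i * bd x (w, t').
      by rewrite /fsum -mulr_fsumr.
    by rewrite cyc mulr0 subr0.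
  + by apply/fin_suppP; exists [:: s] => // u; rewrite inE; case: (u == s) => //; rewrite eqxx.
  + have [q uq qx] := (fin_suppP _).1 fs; apply/fin_suppP; exists q => // u nz.
    by apply: qx; apply: contraNneq nz => ->; rewrite mulr0.
- move=> w' t /y_supp[p /yw_supp[_ _ d]].
  have := len_longest d p; rewrite mulVKg.
  case e : (len (w^-1 * w')) => [|l] <-; last by right; rewrite addnS ltnS leq_addr.
  by left; move/(len_eq0 (cox := cox)): e => /mulg1_eq; rewrite invgK => ->.
Qed.

Lemma aug_fin x : fin_supp x -> fin_supp (fun w => x (w, empty_simplex n V)).
Proof.
move=> /fin_suppP[r _ rx]; apply/fin_suppP; exists (undup (map fst r)).
  exact: undup_uniq.
by move=> w /rx wr; rewrite mem_undup; apply/mapP; exists (w, empty_simplex n V).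
Qed.

Lemma augB k x y : chain k x -> chain k y -> aug (x - y) = aug x - aug y.
Proof. by move=> /chain_fin/aug_fin fx /chain_fin/aug_fin fy; rewrite -fsumB. Qed.

Lemma bd_chain0 x : chain 0 x -> bd x = 0.
Proof.
move=> cx; apply/funext => -[w t]; apply: fsum0 => v /=; rewrite /bd_term.
case: (t (f v) =P None) => // tv; have [->|/(chain_card cx)] := eqVneq (x (w, upd t (f v) (Some v))) 0.
  by rewrite mulr0.
by rewrite card_upd.
Qed.

(** Induction on the maximal length of the support, and for a given length on the
    number of elements of that length.  The hypothesis on [aug] is preserved by
    subtracting a boundary; it enters at the end, when the support is reduced
    to the identity in degree [0]. *)
Lemma chain_exact k x : chain k x -> bd x = 0 -> (k = 0%N -> aug x = 0) ->
  exists2 y, chain k.+1 y & bd y = x.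
Proof.
move=> cx bx ax.
have [N xN] : exists N, forall w t, x (w, t) != 0 -> (len w <= N)%N.
  have [r _ rx] := (fin_suppP x).1 (chain_fin cx).
  exists (\max_(p <- r) len p.1) => w t /rx wr.
  exact: (@leq_bigmax_seq _ r xpredT (fun p => len p.1) (w, t)).
elim: N => [|N IHN] in x cx bx ax xN *.
  exists 0; first exact: chain0.
  have x1 w t : x (w, t) != 0 -> w = 1%g /\ t = empty_simplex n V.
    move=> xw; have w1 : w = 1%g.
      by apply: (len_eq0 (cox := cox)); apply/eqP; rewrite -leqn0 (xN w t).
    split=> //; apply/ffunP => i; rewrite ffunE; case ti: (t i) => [v|//].
    have : (len (w * val v) <= 0)%N by apply: (xN _ t); rewrite (chain_anti cx _ ti) oppr_eq0.
    by rewrite w1 len_ascent ?descent1.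
  have b0 : bd 0 = 0.
    by apply/funext => -[w t]; apply: fsum0 => v; rewrite /bd_term mulr0 if_same.
  rewrite b0; apply/funext => -[w t]; apply/esym/eqP; rewrite -[_ == _]/(x (w, t) == 0).
  apply: contraT => xw; have [w1 te] := x1 _ _ xw.
  have k0 : k = 0%N by rewrite -(chain_card cx xw) te empty_card.
  case/negP: xw; rewrite w1 te -(ax k0) /aug (@fsum1 _ _ _ 1%g) ?eqxx// => u u1.
  by apply/eqP; apply: contraNT u1 => /x1[->].
have [r rx] : exists r : seq G, forall w t, x (w, t) != 0 -> len w = N.+1 -> w \in r.
  have [r _ rx] := (fin_suppP x).1 (chain_fin cx).
  by exists (map fst r) => w t /rx wr _; apply/mapP; exists (w, t).
elim: r => [|w r IHr] in x cx bx ax xN rx *.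
  apply: IHN => // w t xw; rewrite -ltnS ltn_neqAle (xN _ _ xw) andbT.
  by apply/negP => /eqP/(rx _ _ xw).
have [wN|wN] := eqVneq (len w) N.+1; last first.
  apply: IHr => // w' t xw e; have := rx _ _ xw e; rewrite inE => /orP[/eqP w'w|//].
  by rewrite -e w'w eqxx in wN.
have w1 : w <> 1%g by move=> e; rewrite e len1 in wN.
have [||y [cy by_ ysupp]] := cone_step cx w1.
- by move=> t; rewrite bx.
- by move=> w' t /xN; rewrite wN.
have cby := chain_bd cy.
have xE p : (x - bd y) p = x p - bd y p by [].
have supp w' t : (x - bd y) (w', t) != 0 -> (len w' < N.+1)%N \/ (w' != w /\ x (w', t) != 0).
  move=> nz; have [w'w|w'w] := eqVneq w' w.
    by move: nz; rewrite xE w'w by_ subrr eqxx.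
  have [xw|] := eqVneq (x (w', t)) 0; last by right.
  move: nz; rewrite xE xw sub0r oppr_eq0 => /bd_supp[v [_ /ysupp[e|]]].
    by rewrite e eqxx in w'w.
  by rewrite wN; left.
have [|||||z cz bz] := IHr (x - bd y).
- exact: chainB.
- by rewrite (bdB cx cby) bx bd_bd ?subr0//; exact: chain_fin cy.
- by move=> k0; rewrite (augB cx cby) ax// sub0r; move: cy; rewrite k0 => /aug_bd ->; rewrite oppr0.
- by move=> w' t /supp[/ltnW|[_ /xN]].
- move=> w' t /supp[lt e|[ne xw] e]; first by rewrite e ltnn in lt.
  by have := rx _ _ xw e; rewrite inE (negbTE ne).
exists (z - (0 - y)); first by apply: chainB cz _; apply: chainB cy; exact: chain0.
have b0 : bd 0 = 0.
  by apply/funext => -[w' t]; apply: fsum0 => v; rewrite /bd_term mulr0 if_same.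
rewrite (bdB cz); last by apply: chainB cy; exact: chain0.
by rewrite (bdB (chain0 _) cy) b0 bz sub0r opprK subrK.
Qed.

End Complex.


(** * Packing submodules and morphisms *)

(** A subgroup of an abelian group, as an abelian group of its own. *)
Record subzmod (U : zmodType) (P : zmodClosed U) := SubZmod {
  subzmod_val :> U;
  subzmod_valP : subzmod_val \in P }.

HB.instance Definition _ (U : zmodType) (P : zmodClosed U) :=
  [isSub of subzmod P for @subzmod_val U P].
HB.instance Definition _ (U : zmodType) (P : zmodClosed U) :=
  [Choice of subzmod P by <:].
HB.instance Definition _ (U : zmodType) (P : zmodClosed U) :=
  [SubChoice_isSubZmodule of subzmod P by <:].

Section Packing.
Variables (U : zmodType) (P : set U).
Hypotheses (P0 : P 0) (PB : forall x y, P x -> P y -> P (x - y)).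

Definition zpred : pred U := fun x => `[<P x>].

Lemma zpred_closed : zmod_closed zpred.
Proof.
split; first exact/asboolP.
by move=> x y /asboolP Px /asboolP Py; apply/asboolP; apply: PB.
Qed.

Definition zclosed : zmodClosed U :=
  HB.pack zpred (GRing.isZmodClosed.Build U zpred zpred_closed).

Lemma zclosedP x : reflect (P x) (x \in zclosed).
Proof. exact: asboolP. Qed.

End Packing.

Definition additive_of (U W : zmodType) (f : U -> W) (fB : zmod_morphism f) :
  {additive U -> W} := HB.pack f (GRing.isZmodMorphism.Build U W f fB).

(** * The resolution by anti-invariants *)

Section Resolution.
Variables (G : groupType) (V : set G) (m : V -> V -> option nat).
Hypothesis cox : coxeter_system m.
Variables (n : nat) (f : V -> 'I_n).
Hypothesis f_inj : forall s t, s <> t -> finite_set (parabolic [set s; t]) -> f s <> f t.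
Variable K : groupClosed G.
Hypothesis K_normal : forall h w, h \in K -> (w^-1 * h * w)%g \in K.
Hypothesis K_free : forall (T : set V) u, finite_set (parabolic T) -> parabolic T u ->
  u \in K -> u = 1%g.

Local Notation F := (csimplex n V).
Local Notation H := (subgroup_of K).
Local Notation chainp k := (chain f k).

Definition chain_closed k : zmodClosed (G * F -> int) :=
  zclosed (@chain0 G V n f k) (@chainB G V n f k).

Definition chain_mod k := subzmod (chain_closed k).

Lemma chainP k (x : chain_mod k) : chainp k (subzmod_val x).
Proof. exact: elimT (zclosedP _ _ _) (subzmod_valP x). Qed.

Definition mk_chain k x (cx : chainp k x) : chain_mod k :=
  SubZmod (introT (zclosedP _ _ x) cx).

Lemma chain_ext k (x y : chain_mod k) : subzmod_val x = subzmod_val y -> x = y.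
Proof. exact: val_inj. Qed.

Definition shift (h : G) (x : G * F -> int) : G * F -> int :=
  fun p => x ((h^-1 * p.1)%g, p.2).

Lemma chain_shift k h x : chainp k x -> chainp k (shift h x).
Proof.
case=> x1 x2 x3 x4; split.
- apply: (fin_supp_inj (h' := fun p => ((h * p.1)%g, p.2)) _ x1) => -[w t] /=.
  by rewrite mulVKg.
- by move=> w t; apply: x2.
- by move=> w t i v; apply: x3.
- by move=> w t i v ti; rewrite /shift /= mulgA (x4 _ _ _ _ ti).
Qed.

Definition chain_act_fun k (h : H) (x : chain_mod k) : chain_mod k :=
  mk_chain (chain_shift (val h) (chainP x)).

Lemma chain_act_additive k h : zmod_morphism (@chain_act_fun k h).
Proof. by move=> x y; apply: chain_ext. Qed.

Definition chain_act k (h : H) : {additive chain_mod k -> chain_mod k} :=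
  additive_of (@chain_act_additive k h).

Lemma chain_act1 k x : chain_act k 1%g x = x.
Proof.
apply: chain_ext; apply/funext => -[w t] /=.
by rewrite /shift /= invg1 mul1g.
Qed.

Lemma chain_actM k (g h : H) x : chain_act k (g * h)%g x = chain_act k g (chain_act k h x).
Proof.
apply: chain_ext; apply/funext => -[w t] /=.
by rewrite /shift /= invgM mulgA.
Qed.

Definition chain_gmod k : gmodule H := GModule (@chain_act1 k) (@chain_actM k).

Definition bd_fun k (x : chain_mod k.+1) : chain_mod k := mk_chain (chain_bd (chainP x)).

Lemma bd_additive k : zmod_morphism (@bd_fun k).
Proof. by move=> x y; apply: chain_ext; rewrite /= (bdB (chainP x) (chainP y)). Qed.

Lemma bd_equivariant k (h : H) (x : chain_mod k.+1) :
  additive_of (@bd_additive k) (chain_act k.+1 h x) =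
  chain_act k h (additive_of (@bd_additive k) x).
Proof. by apply: chain_ext. Qed.

Definition bd_hom k : gm_hom (chain_gmod k.+1) (chain_gmod k) :=
  @GmHom H (chain_gmod k.+1) (chain_gmod k) _ (@bd_equivariant k).

Definition aug_fun (x : chain_mod 0) : int := aug (subzmod_val x).

Lemma aug_additive : zmod_morphism aug_fun.
Proof. by move=> x y; rewrite /aug_fun /= (augB (chainP x) (chainP y)). Qed.

Lemma aug_equivariant (h : H) (x : chain_mod 0) :
  additive_of aug_additive (chain_act 0 h x) = additive_of aug_additive x.
Proof.
rewrite /= /aug_fun /aug.
apply: (@fsum_reindex _ _ (fun w => subzmod_val x (w, _)) (fun w => (val h)^-1 * w)%g
  (fun w => val h * w)%g) => w; rewrite ?mulVKg// mulKg//.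
Qed.

Definition aug_hom : gm_hom (chain_gmod 0) (gm_trivial H) :=
  @GmHom H (chain_gmod 0) (gm_trivial H) _ aug_equivariant.

Lemma aug_surjective : gm_surjective aug_hom.
Proof.
move=> a; pose x (p : G * F) : int := if p == (1%g, empty_simplex n V) then a else 0.
have cx : chainp 0 x.
  have xs p : x p != 0 -> p = (1%g, empty_simplex n V).
    by rewrite /x; case: (p =P _) => // _; rewrite eqxx.
  split.
  - by apply/fin_suppP; exists [:: (1%g, empty_simplex n V)] => // p /xs ->; rewrite inE.
  - by move=> w t /xs[_ ->]; rewrite empty_card.
  - by move=> w t i v /xs[_ ->]; rewrite ffunE.
  - move=> w t i v ti; rewrite /x !xpair_eqE; case: (t =P _) => [te|_].
      by rewrite te ffunE in ti.
    by rewrite !andbF oppr0.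
exists (mk_chain cx); rewrite /= /aug_fun /aug /= (@fsum1 _ _ _ 1%g) => [|w w1].
  by rewrite /x eqxx.
by rewrite /x xpair_eqE (negbTE w1).
Qed.

Lemma bd_exact k : gm_exact (bd_hom k.+1) (bd_hom k).
Proof.
move=> x; split=> [|[y <-]]; last first.
  by apply: chain_ext; rewrite /= (bd_bd _ (chain_fin (chainP y))).
move/(congr1 (@subzmod_val _ _)) => /= bx.
have [//|y cy yx] := chain_exact cox f_inj (chainP x) bx _.
by exists (mk_chain cy); apply: chain_ext.
Qed.

Lemma aug_exact : gm_exact (bd_hom 0) aug_hom.
Proof.
move=> x; split=> [ax|[y <-]]; last exact: (aug_bd cox (chainP y)).
have [//|//|y cy yx] := chain_exact cox f_inj (chainP x).
  exact: (bd_chain0 (chainP x)).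
by exists (mk_chain cy); apply: chain_ext.
Qed.

Section Projective.
Variables (k : nat) (sgn : G -> bool).
Hypotheses (sgnM : forall g h, sgn (g * h)%g = sgn g (+) sgn h)
  (sgnv : forall v : V, sgn (val v)).
Implicit Types (t : F) (w : G).

Let P t := parabolic (vert t).

Lemma sgn1 : sgn 1%g = false.
Proof. by have := sgnM 1%g 1%g; rewrite mulg1; case: (sgn 1%g). Qed.

Lemma chain_parabolic x w t u : chainp k x -> P t u ->
  x ((w * u)%g, t) = (-1) ^+ sgn u * x (w, t).
Proof.
move=> cx [s <-]; elim/last_ind: s => [|s v IH] st.
  by rewrite prd_nil sgn1 mulg1 expr0 mul1r.
have [i ti] : vert t v by apply: st; rewrite mem_rcons mem_head.
rewrite prd_rcons mulgA (chain_anti cx _ ti) IH => [|a sa]; last first.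
  by apply: st; rewrite mem_rcons inE sa orbT.
by rewrite sgnM sgnv addbT; case: (sgn _); rewrite ?expr0 ?expr1 ?mulN1r ?mul1r ?opprK.
Qed.

(** The sets of vertices that support a nonzero chain of degree [k]. *)
Definition good t := [/\ card_simplex t = k, forall i v, t i = Some v -> f v = i &
  finite_set (P t)].

Lemma chain_good x w t : chainp k x -> x (w, t) != 0 -> good t.
Proof.
move=> cx xw; split; first exact: (chain_card cx xw).
  by move=> i v; apply: (chain_color cx xw).
apply: (@sub_finite_set _ _ ((fun p => (w^-1 * p.1)%g) @` [set p | x p != 0])).
  move=> u Pu; exists ((w * u)%g, t); rewrite /= ?mulKg//.
  by rewrite (chain_parabolic _ cx Pu) mulf_neq0// signr_eq0.
exact/finite_image/(chain_fin cx).
Qed.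

(** The generator, up to sign, of the chains carried by the coset of [w]. *)
Definition cell w t : G * F -> int := fun p =>
  if (p.2 == t) && `[< P t (w^-1 * p.1)%g >] then (-1) ^+ sgn (w^-1 * p.1)%g else 0.

Lemma chain_cell w t : good t -> chainp k (cell w t).
Proof.
case=> kt ct fP; split.
- apply: (@sub_finite_set _ _ ((fun u => ((w * u)%g, t)) @` P t)); last exact: finite_image.
  move=> [w' t']; rewrite /= /cell /=; case: (t' =P t) => [->|//] /=.
  case: asboolP => [p _|//].
  by exists (w^-1 * w')%g; rewrite ?mulVKg.
- by move=> w' t'; rewrite /cell /=; case: (t' =P t) => [->|].
- move=> w' t' i v; rewrite /cell /=; case: (t' =P t) => [-> _|//].
  exact: ct.
- move=> w' t' i v ti; rewrite /cell /=; case: (t' =P t) => [te|_] /=; last by rewrite oppr0.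
  rewrite mulgA (parabolic_mulgen cox); last by exists i; rewrite -te.
  case: ifP => _; last by rewrite oppr0.
  by rewrite sgnM sgnv addbT; case: (sgn _); rewrite ?expr0 ?expr1 ?opprK.
Qed.

(** The value [0] for the other simplices makes the family of all cells
    equivariant without side conditions. *)
Definition cell_chain w t : chain_mod k :=
  if pselect (good t) is left gt then mk_chain (chain_cell w gt)
  else mk_chain (chain0 f k).

Lemma cell_chainE w t : good t -> subzmod_val (cell_chain w t) = cell w t.
Proof. by rewrite /cell_chain; case: pselect. Qed.

Lemma cell_shift (h : H) w t : chain_act k h (cell_chain w t) = cell_chain (val h * w)%g t.
Proof.
apply: chain_ext; rewrite /cell_chain; case: pselect => // gt /=.
by apply/funext => -[w' t']; rewrite /shift /cell /= invgM mulgA.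
Qed.

Definition rcos w : set G := [set (val h * w)%g | h in [set: H]].

Lemma rcosM (h : H) w : rcos (val h * w)%g = rcos w.
Proof.
apply/seteqP; split=> _ [g _ <-].
  by exists (g * h)%g => //; rewrite /= mulgA.
by exists (g * h^-1)%g => //=; rewrite mulgA mulgVK.
Qed.

Lemma rcos_refl w : rcos w w.
Proof. by exists 1%g => //; rewrite /= mul1g. Qed.

(** The simplex [t] being given, choose a right coset of [K] in each of the double
    cosets of [K] and [P t], and keep the elements of the chosen ones.  They are
    stable under [K], and a left coset of [P t] contains exactly one of them,
    because [K] is normal and meets [P t] trivially. *)
Definition transv w t : Prop :=
  rcos w = get [set c | exists2 u, P t u & c = rcos (w * u)%g].

Lemma transv_shift (h : H) w t : transv (val h * w)%g t <-> transv w t.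
Proof.
rewrite /transv rcosM.
have -> : [set c | exists2 u, P t u & c = rcos (val h * w * u)%g] =
          [set c | exists2 u, P t u & c = rcos (w * u)%g] => [|//].
by apply/seteqP; split=> _ [u Pu ->]; exists u => //; rewrite -mulgA rcosM.
Qed.

Lemma transv_cos w t u : P t u ->
  [set c | exists2 u', P t u' & c = rcos (w * u * u')%g] =
  [set c | exists2 u', P t u' & c = rcos (w * u')%g].
Proof.
move=> Pu; apply/seteqP; split=> _ [u' Pu' ->].
  by exists (u * u')%g; rewrite ?mulgA//; apply: parabolicM.
exists (u^-1 * u')%g; last by rewrite mulgA mulgK.
by apply: parabolicM => //; apply: (parabolicV cox).
Qed.

Lemma transv_exists w t : exists2 u, P t u & transv (w * u)%g t.
Proof.
set E := [set c | exists2 u, P t u & c = rcos (w * u)%g].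
have [u Pu e] : E (get E).
  by apply: getPex; exists (rcos w); exists 1%g; rewrite ?mulg1//; apply: parabolic1.
by exists u => //; rewrite /transv transv_cos// -/E e.
Qed.

Lemma transv_uniq w t u : finite_set (P t) -> P t u -> transv w t -> transv (w * u)%g t -> u = 1%g.
Proof.
move=> fP Pu; rewrite /transv transv_cos// => <- e.
have : rcos w (w * u)%g by rewrite -e; apply: rcos_refl.
case=> h _ hw; apply: (K_free fP Pu).
have -> : u = (w^-1 * val h * w)%g by rewrite -mulgA hw mulKg.
by apply: K_normal; apply: subgroup_valP.
Qed.

Definition rcos_rep w : G := xget 1%g (rcos w).

Lemma rcos_repP w : exists h : H, (val h * rcos_rep w)%g = w.
Proof.
have [h _ hw] : rcos w (rcos_rep w) := xgetPex 1%g (ex_intro _ w (rcos_refl w)).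
by exists h^-1%g; rewrite -hw /= mulgA mulVg mul1g.
Qed.

Definition rcos_quo w : H := projT1 (cid (rcos_repP w)).

Lemma rcos_quoE w : (val (rcos_quo w) * rcos_rep w)%g = w.
Proof. by rewrite /rcos_quo; case: cid. Qed.

Lemma rcos_rep_shift (h : H) w : rcos_rep (val h * w)%g = rcos_rep w.
Proof. by rewrite /rcos_rep rcosM. Qed.

Lemma rcos_quo_shift (h : H) w : rcos_quo (val h * w)%g = (h * rcos_quo w)%g.
Proof.
apply: val_inj; apply: (mulIg (rcos_rep w)).
by rewrite -{1}(rcos_rep_shift h w) rcos_quoE /= -mulgA rcos_quoE.
Qed.

(** The cells [cell_chain w t] with [transv w t] form a basis, permuted freely by
    [K].  Liftings are chosen for one cell in each orbit and moved around by
    [rcos_quo]; a chain is lifted through its coefficients in that basis. *)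
Lemma chain_projective : gm_projective (chain_gmod k).
Proof.
move=> M N p phi psurj.
have [mu0 mu0P] := @choice _ _ (fun (q : G * F) y => p y = phi (cell_chain q.1 q.2))
  (fun q => psurj _).
pose mu (q : G * F) : M := gm_act M (rcos_quo q.1) (mu0 (rcos_rep q.1, q.2)).
have muP q : p (mu q) = phi (cell_chain q.1 q.2).
  rewrite /mu gm_funE mu0P -[in RHS](rcos_quoE q.1) -cell_shift.
  exact/esym/(gm_funE phi).
have mu_shift (h : H) w t : mu ((val h * w)%g, t) = gm_act M h (mu (w, t)).
  by rewrite /mu /= rcos_rep_shift rcos_quo_shift gm_actM.
pose coef (x : chain_mod k) (q : G * F) : int :=
  if `[< transv q.1 q.2 >] then subzmod_val x q else 0.
have coef_supp x q : coef x q != 0 -> subzmod_val x q != 0.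
  by rewrite /coef; case: ifP => //; rewrite eqxx.
have coef_fin (A : zmodType) (F' : G * F -> A) x : fin_supp (fun q => F' q *~ coef x q).
  have [r ur rx] := (fin_suppP _).1 (chain_fin (chainP x)); apply/fin_suppP; exists r => // q nz.
  by apply/rx/coef_supp; apply: contraNneq nz => ->; rewrite mulr0z.
pose lift (x : chain_mod k) : M := fsum (fun q => mu q *~ coef x q).
have liftB : zmod_morphism lift.
  move=> x y; rewrite /lift -fsumB//; apply: eq_fsum => q; rewrite -mulrzBr; congr (_ *~ _).
  by rewrite /coef; case: ifP; rewrite ?subr0.
have lift_eq (h : H) (x : chain_mod k) :
    additive_of liftB (chain_act k h x) = gm_act M h (additive_of liftB x).
  rewrite /= /lift fsum_morph//.
  rewrite -[LHS](@fsum_reindex _ _ _ (fun q : G * F => ((val h * q.1)%g, q.2))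
    (fun q : G * F => (((val h)^-1 * q.1)%g, q.2))).
  - apply: eq_fsum => -[w t] /=; rewrite mu_shift raddfMz; congr (_ *~ _).
    rewrite /coef /= /shift /= mulKg.
    have -> // : `[< transv (val h * w)%g t >] = `[< transv w t >].
    by apply/asboolP/asboolP => /transv_shift.
  - by move=> [w t] /=; rewrite mulKg.
  - by move=> [w t] /=; rewrite mulVKg.
exists (@GmHom H (chain_gmod k) M _ lift_eq) => x.
have [r ur rx] := (fin_suppP _).1 (chain_fin (chainP x)).
rewrite /= /lift fsum_morph// (@fsumE _ _ _ r) => //; last first.
  by move=> q nz; apply/rx/coef_supp; apply: contraNneq nz => ->; rewrite mulr0z raddf0.
rewrite [RHS](_ : phi x = phi (\sum_(q <- r) (cell_chain q.1 q.2 *~ coef x q : chain_mod k))); last first.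
  congr (phi _); apply: chain_ext; apply/funext => -[w' t].
  have -> : subzmod_val (\sum_(q <- r) (cell_chain q.1 q.2 *~ coef x q : chain_mod k)) (w', t) =
      \sum_(q <- r) subzmod_val (cell_chain q.1 q.2) (w', t) * coef x q.
    elim: (r) => [|q r' IH]; first by rewrite !big_nil.
    rewrite !big_cons -IH -[LHS]/(subzmod_val _ _ + subzmod_val _ _); congr (_ + _).
    rewrite -mulrzz; case: (coef x q) => j.
      elim: j => [|j IHj]; first by rewrite !mulr0z.
      by rewrite -!pmulrn !mulrS; congr (_ + _); rewrite !pmulrn.
    rewrite NegzE !mulrNz -[LHS]/(- subzmod_val _ _); congr (- _).
    elim: j => [|j IHj]; first by rewrite !mulr1z.
    by rewrite -!pmulrn !(mulrS _ j.+1); congr (_ + _); rewrite !pmulrn.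
  have [u Pu tu] := transv_exists w' t.
  have [xw|xw] := eqVneq (subzmod_val x (w', t)) 0.
    rewrite xw big1// => -[w t'] _ /=.
    have [-> |cw] := eqVneq (coef x (w, t')) 0; first by rewrite mulr0.
    have gt := chain_good (chainP x) (coef_supp _ _ cw).
    rewrite cell_chainE// /cell /=; case: (t =P t') => [e|_] /=; last by rewrite mul0r.
    case: asboolP => [Pw|_]; last by rewrite mul0r.
    move/coef_supp: cw; rewrite -e in Pw *.
    have := chain_parabolic w (chainP x) Pw; rewrite mulVKg xw => /esym/eqP.
    by rewrite mulf_eq0 signr_eq0 => /= ->.
  have gt := chain_good (chainP x) xw.
  have xu : subzmod_val x ((w' * u)%g, t) = (-1) ^+ sgn u * subzmod_val x (w', t).
    exact: chain_parabolic (chainP x) Pu.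
  have nz : subzmod_val x ((w' * u)%g, t) != 0 by rewrite xu mulf_neq0// signr_eq0.
  rewrite (bigD1_seq _ (rx _ nz) ur) /= big1 ?addr0.
    rewrite cell_chainE// /cell /= eqxx /= invgM mulgVK.
    have PV : P t u^-1%g by apply: (parabolicV cox).
    rewrite asboolT// /coef /= asboolT// xu mulrA -exprD.
    have -> : sgn u^-1%g = sgn u.
      by have := sgnM u u^-1%g; rewrite mulgV sgn1; case: (sgn u); case: (sgn _).
    by case: (sgn u); rewrite ?expr0 ?mul1r// expr2 mulN1r opprK mul1r.
  move=> [w t'] /= ne.
  have [-> |cw] := eqVneq (coef x (w, t')) 0; first by rewrite mulr0.
  have gt' := chain_good (chainP x) (coef_supp _ _ cw).
  rewrite cell_chainE// /cell /=; case: (t =P t') => [e|_] /=; last by rewrite mul0r.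
  case: asboolP => [Pw|_]; last by rewrite mul0r.
  rewrite -e in Pw cw ne *; case/negP: ne.
  have tw : transv w t by move: cw; rewrite /coef /=; case: asboolP => // _; rewrite eqxx.
  have e1 : (w * (w^-1 * w' * u))%g = (w' * u)%g by rewrite !mulgA mulgV mul1g.
  have := @transv_uniq w t (w^-1 * w' * u)%g; rewrite e1 => /(_ _ _ tw tu) ue.
  by rewrite -e1 ue ?mulg1//; [case: gt | apply: parabolicM].
rewrite raddf_sum; apply: eq_bigr => q _.
by rewrite !raddfMz muP.
Qed.

End Projective.

Lemma chain_mod_eq0 k (x : chain_mod k) : (n < k)%N -> x = 0.
Proof.
move=> nk; apply: chain_ext; apply/funext => -[w t]; apply/eqP.
apply: contraT => /(chain_card (chainP x)) e.
by have := card_simplex_le t; rewrite e leqNgt nk.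
Qed.

Theorem finite_resolution : finite_cd H.
Proof.
exists n, chain_gmod, bd_hom, aug_hom; split.
- move=> k; have [sgn [sgnM sgnv]] := coxeter_sign cox.
  exact: (chain_projective sgnM sgnv).
- exact: aug_surjective.
- exact: aug_exact.
- exact: bd_exact.
- by move=> i ni x; apply: chain_mod_eq0.
Qed.

End Resolution.


Import Order.TTheory Num.Theory.

(** * Chebyshev sequences *)

Section Chebyshev.
Variable R : realFieldType.

Fixpoint cheb2 (th : R) (j : nat) : R * R :=
  if j is j'.+1 then let: (a, b) := cheb2 th j' in (b, th * b - a) else (0, 1).

Definition cheb th j : R := (cheb2 th j).1.

Lemma cheb0 th : cheb th 0 = 0. Proof. by []. Qed.
Lemma cheb1 th : cheb th 1 = 1. Proof. by []. Qed.

Lemma chebSS th j : cheb th j.+2 = th * cheb th j.+1 - cheb th j.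
Proof. by rewrite /cheb /=; case: (cheb2 th j). Qed.

(** The properties of [2 cos (pi / k)] that make it the parameter of a
    dihedral group of order [2 k]. *)
Record dihedral_param (th : R) (k : nat) : Prop := DihedralParam {
  dp_period : cheb th k = 0 /\ cheb th k.+1 = -1;
  dp_neq : th ^+ 2 != 4;
  dp_pos : forall j, (0 < j < k)%N -> 0 < cheb th j }.

(** The recursion is linear, so two consecutive values determine the rest. *)
Lemma cheb_shift th k j : cheb th k = 0 -> cheb th k.+1 = -1 ->
  cheb th (k + j) = - cheb th j.
Proof.
move=> h0 h1; have [//] : cheb th (k + j) = - cheb th j /\ cheb th (k + j.+1) = - cheb th j.+1.
elim: j => [|j [IH1 IH2]]; first by rewrite addn0 addn1 h0 h1 cheb0 cheb1 oppr0.
by split=> //; rewrite !addnS chebSS -addnS IH2 IH1 chebSS; ring.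
Qed.

Lemma cheb_ge0 th k j : dihedral_param th k -> (j <= k)%N -> 0 <= cheb th j.
Proof.
case=> [[u0 _] _ pos]; rewrite leq_eqVlt => /orP[/eqP ->|jk]; first by rewrite u0.
by case: j jk => [|j] jk; rewrite ?cheb0// ltW// pos.
Qed.

Lemma dihedral_order th k j : dihedral_param th k -> (0 < j < k)%N ->
  cheb th j.*2 = 0 -> cheb th j.*2.+1 <> 1.
Proof.
move=> [[u0 u1] _ pos] jk e0.
have [lt|] := ltnP j.*2 k; last rewrite leq_eqVlt => /orP[/eqP kj|gt].
- move=> _; have := pos j.*2; rewrite e0 ltxx => h.
  by suff : false by []; apply: h; lia.
- by rewrite -kj u1; lra.
- move=> _; have := @cheb_shift th k (j.*2 - k) u0 u1; rewrite subnKC ?(ltnW gt)// e0.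
  move=> /esym/eqP; rewrite oppr_eq0 => /eqP z.
  have := pos (j.*2 - k)%N; rewrite z ltxx => h.
  by suff : false by []; apply: h; move: jk gt; lia.
Qed.

End Chebyshev.

Section Trigonometric.
Variable R : realType.

Definition twocos (k : nat) : R := 2 * cos (pi / k%:R).

Lemma twocos_param k : (2 <= k)%N -> dihedral_param (twocos k) k.
Proof.
move=> k2; set phi : R := pi / k%:R.
have k0 : 0 < k%:R :> R by rewrite ltr0n; lia.
have phik : phi * k%:R = pi by rewrite /phi divfK// gt_eqF.
have sin_pos j : (0 < j < k)%N -> 0 < sin (j%:R * phi).
  move=> /andP[j0 jk]; apply: sin_gt0_pi; rewrite mulr_gt0 ?ltr0n// ?divr_gt0 ?pi_gt0//=.
  by rewrite -phik mulrC ltr_pM2l ?ltr_nat// divr_gt0 ?pi_gt0.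
have s1 : 0 < sin phi by rewrite -[phi]mul1r; apply: (sin_pos 1%N); lia.
have E j : cheb (twocos k) j * sin phi = sin (j%:R * phi).
  have [//] : cheb (twocos k) j * sin phi = sin (j%:R * phi) /\
              cheb (twocos k) j.+1 * sin phi = sin (j.+1%:R * phi).
  elim: j => [|j [IH1 IH2]].
    by rewrite cheb0 cheb1 !mul0r mul1r sin0 mul1r.
  split=> //; rewrite chebSS mulrBl -mulrA IH1 IH2 /twocos -/phi.
  have -> : j.+2%:R * phi = j.+1%:R * phi + phi by rewrite -[j.+2%:R]natr1; ring.
  have -> : j%:R * phi = j.+1%:R * phi - phi by rewrite -[j.+1%:R]natr1; ring.
  rewrite !sinD sinN cosN; ring.
have sk : sin (k%:R * phi) = 0 by rewrite mulrC phik sinpi.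
have cancel a b : a * sin phi = b * sin phi -> a = b by apply: mulIf; rewrite gt_eqF.
split.
- split; first by apply: cancel; rewrite E sk mul0r.
  apply: cancel; rewrite E -natr1 mulrDl [k%:R * _]mulrC phik mul1r addrC sinDpi mulN1r//.
- rewrite /twocos -/phi; have := cos2Dsin2 phi => e; apply/negP => /eqP e4.
  have s2 : 0 < sin phi ^+ 2 by rewrite exprn_gt0.
  have z : sin phi ^+ 2 = 0 by move: e4; rewrite exprMn => e4; lra.
  by rewrite z ltxx in s2.
- by move=> j /sin_pos; rewrite -E pmulr_lgt0.
Qed.

End Trigonometric.

(** * Reflection representations *)

Section Reflections.
Variables (R : realFieldType) (I : Type) (c : I -> I -> R).
Implicit Types (h : I -> R) (i j l : I).

Definition refl i h : I -> R := fun l => h l - c i l * h i.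

Fixpoint altf n i j h : I -> R := if n is n'.+1 then refl i (altf n' j i h) else h.

Lemma altf_iter n i j h : iter n (fun h => refl i (refl j h)) h = altf n.*2 i j h.
Proof. by elim: n => //= n ->. Qed.

Section Dihedral.
Variables (th : R) (i j : I).
Hypotheses (cii : c i i = 2) (cjj : c j j = 2) (cij : c i j = - th) (cji : c j i = - th).
Variable h : I -> R.

Definition alt_val n : R := cheb th n.+1 * h j + cheb th n * h i.

Lemma alt_valSS n : alt_val n.+2 = th * alt_val n.+1 - alt_val n.
Proof. by rewrite /alt_val !chebSS; ring. Qed.

(** Apply the reflections alternately, [j] being the first one.  The coordinate
    about to be reflected follows the Chebyshev recursion, and the one just
    reflected has changed its sign.  The parity of [n] decides which of [i] and
    [j] is which. *)
Lemma altf_val n :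
  (if odd n then altf n j i h i else altf n i j h j) = alt_val n /\
  (if odd n then altf n.+1 i j h i else altf n.+1 j i h j) = - alt_val n.
Proof.
have neg i' (e : c i' i' = 2) h' : refl i' h' i' = - h' i' by rewrite /refl e; ring.
have [//] : ((if odd n then altf n j i h i else altf n i j h j) = alt_val n /\
   (if odd n then altf n.+1 i j h i else altf n.+1 j i h j) = - alt_val n) /\
  (if odd n then altf n.+1 i j h j else altf n.+1 j i h i) = alt_val n.+1.
elim: n => [|n [[IH1 IH2] IH3]].
  split; first split => /=.
  - by rewrite /alt_val cheb1 cheb0; ring.
  - by rewrite neg// /alt_val cheb1 cheb0; ring.
  - by rewrite /= /refl cji /alt_val chebSS cheb1 cheb0; ring.
rewrite alt_valSS; move: IH1 IH2 IH3; rewrite [odd n.+1]/=; case: (odd n) => /= IH1 IH2 IH3.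
  split; first by rewrite IH3 neg// IH3.
  by rewrite {1}/refl IH2 IH3 cji; ring.
split; first by rewrite IH3 neg// IH3.
by rewrite {1}/refl IH2 IH3 cij; ring.
Qed.

Lemma altf_double n l : altf n.*2 i j h l =
  h l - c j l * (\sum_(p < n) alt_val p.*2) - c i l * (\sum_(p < n) alt_val p.*2.+1).
Proof.
elim: n => [|n IH]; first by rewrite !big_ord0 /=; ring.
rewrite doubleS /= !big_ord_recr /= {1}/refl.
have [e1 _] := altf_val n.*2.+1; have [e2 _] := altf_val n.*2.
move: e1 e2; rewrite /= odd_double /= => e1 e2.
rewrite e1 {1}/refl e2 IH; ring.
Qed.

(** The [2 k] values subtracted along the relator split into two sums [S] and [T],
    one for each reflection.  Adding up the recursion over a period yields
    [2 S = th T] and [2 T = th S], and both vanish as [th ^ 2] is not [4]. *)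
Lemma altf_relation k : dihedral_param th k -> altf k.*2 i j h =1 h.
Proof.
move=> [[u0 u1] th4 _] l; rewrite altf_double.
have per p : alt_val (k.*2 + p) = alt_val p.
  by rewrite /alt_val -addnS -addnn -!addnA !cheb_shift// !opprK.
set S := \sum_(p < k) alt_val p.*2; set T := \sum_(p < k) alt_val p.*2.+1.
have cycle (F : nat -> R) : F k = F 0%N -> \sum_(p < k) F p.+1 = \sum_(p < k) F p.
  move=> F0; apply: (addrI (F 0%N)); rewrite -(big_ord_recl k (fun p => F p)).
  by rewrite big_ord_recr /= F0 addrC.
have S1 : \sum_(p < k) alt_val p.*2.+2 = S.
  by apply: (cycle (fun p => alt_val p.*2)); rewrite -[k.*2]addn0 per.
have T1 : \sum_(p < k) alt_val p.*2.+3 = T.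
  by apply: (cycle (fun p => alt_val p.*2.+1)); rewrite -[k.*2]addn0 -addnS per.
have ST : S + S = th * T.
  rewrite -{1}S1 -big_split mulr_sumr; apply: eq_bigr => p _ /=.
  by rewrite alt_valSS; ring.
have TS : T + T = th * S.
  rewrite -{1}T1 -S1 -big_split mulr_sumr; apply: eq_bigr => p _ /=.
  by rewrite (alt_valSS p.*2.+1); ring.
have S0 : S = 0.
  have : (4 - th ^+ 2) * S = 0 by rewrite mulrBl expr2 -mulrA -TS mulrDr -ST; ring.
  by move=> /eqP; rewrite mulf_eq0 subr_eq0 eq_sym (negbTE th4) => /eqP.
have T0 : T = 0 by move: TS; rewrite S0 mulr0; lra.
by rewrite S0 T0; ring.
Qed.

End Dihedral.
End Reflections.

Section Representation.
Variables (G : groupType) (V : set G) (m : V -> V -> option nat).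
Hypothesis cox : coxeter_system m.
Variables (R : realFieldType) (I : Type) (g : V -> I) (c : I -> I -> R).
Variable th : nat -> R.
Hypothesis thP : forall k, (2 <= k)%N -> dihedral_param (th k) k.
Hypothesis cii : forall i, c i i = 2.
Hypothesis cE : forall v w k, v <> w -> m v w = Some k -> c (g v) (g w) = - th k.

Lemma cE' v w k : v <> w -> m v w = Some k -> c (g w) (g v) = - th k.
Proof. by move=> vw mvw; apply: cE; [exact/nesym | rewrite (cox_sym cox)]. Qed.

Lemma reflection_action : exists act : G -> (I -> R) -> (I -> R),
  [/\ forall h, act 1%g h = h,
      forall x y h, act (x * y)%g h = act x (act y h)
    & forall (v : V) h, act (val v) h = refl c (g v) h].
Proof.
apply: (coxeter_action cox (sigma := fun v => refl c (g v))) => v w k mvw h.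
have [e|/eqP vw] := eqVneq v w.
  move: mvw; rewrite -e (cox_diag cox) => -[<-] /=.
  by apply/funext => l; rewrite /refl cii; ring.
rewrite altf_iter; apply/funext => l.
apply: (@altf_relation _ _ _ (th k)); rewrite ?cii//; first exact: cE.
  exact: cE'.
exact/thP/(cox_ge2 cox vw).
Qed.

Variable act : G -> (I -> R) -> (I -> R).
Hypothesis act1 : forall h, act 1%g h = h.
Hypothesis actM : forall x y h, act (x * y)%g h = act x (act y h).
Hypothesis actv : forall (v : V) h, act (val v) h = refl c (g v) h.

Lemma act_pow v w j h : act ((val v * val w) ^+ j)%g h = altf c j.*2 (g v) (g w) h.
Proof.
elim: j => [|j IH]; first by rewrite act1.
by rewrite expgS actM IH actM !actv.
Qed.

Fixpoint alt j (x y : V) : G := if j is j'.+1 then (val x * alt j' y x)%g else 1%g.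

Lemma act_alt j x y h : act (alt j x y) h = altf c j (g x) (g y) h.
Proof. by elim: j x y => [|j IH] x y; rewrite /= ?act1// actM actv IH. Qed.

Lemma alt_add i j x y :
  alt (i + j) x y = (alt i x y * (if odd i then alt j y x else alt j x y))%g.
Proof.
elim: i x y => [|i IH] x y; first by rewrite mul1g.
by rewrite addSn /= IH mulgA; case: (odd i).
Qed.

Lemma alt_double j x y : alt j.*2 x y = ((val x * val y) ^+ j)%g.
Proof. by elim: j => //= j ->; rewrite expgS mulgA. Qed.

Lemma altV j x y : ((alt j x y)^-1 = if odd j then alt j x y else alt j y x)%g.
Proof.
elim: j x y => [|j IH] x y; first by rewrite invg1.
rewrite [alt _ _ _]/= invgM (genV cox) IH.
have snoc a b : (alt j a b * val (if odd j then b else a))%g = alt j.+1 a b.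
  by rewrite -addn1 alt_add; case: (odd j); rewrite /= mulg1.
have := snoc y x; have := snoc x y.
by rewrite oddS; case: (odd j).
Qed.

Lemma alt_braid x y k : m x y = Some k -> alt k x y = alt k y x.
Proof.
move=> mxy; have : alt k.*2 x y = 1%g by rewrite alt_double (cox_rel cox mxy).
rewrite -addnn alt_add => /mulg1_eq; rewrite altV.
by case: (odd k) => ->.
Qed.

Lemma len_alt j x y : (len cox (alt j x y) <= j)%N.
Proof.
elim: j x y => [|j IH] x y; first by rewrite /= len1.
apply: leq_trans (lenM _ _ _) _; rewrite -add1n; apply: leq_add (IH _ _).
by have := len_prd cox [:: x]; rewrite prd_cons prd_nil mulg1.
Qed.

(** Letters [x] and [y] are removed alternately on the right of [w] until the
    length stops dropping.  The letter just removed would increase the length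
    again, so that in the end neither [x] nor [y] is a descent. *)
Lemma peel (T : set V) w x y : T x -> T y -> parabolic T w -> ~~ descent cox w y ->
  exists j w', [/\ parabolic T w', ~~ descent cox w' x, ~~ descent cox w' y,
    len cox w = (j + len cox w')%N & (w^-1 = alt j x y * w'^-1)%g].
Proof.
move=> + + + dy; have [N] := ubnP (len cox w); elim: N => // N IH in w x y dy *.
move=> lw Tx Ty Tw; have [dx|dx] := boolP (descent cox w x); last first.
  by exists 0%N, w; split=> //; rewrite mul1g.
have lx := len_descent dx.
have [|||||j [w' [Tw' d1 d2 le we]]] := IH (w * val x)%g y x.
- by rewrite descent_mul negbK.
- by move: lw; rewrite lx.
- by [].
- by [].
- by apply: parabolicM => //; apply: parabolic_gen.
exists j.+1, w'; split=> //; first by rewrite lx le.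
by rewrite /= -mulgA -we invgM (genV cox) mulgA (genK cox) mul1g.
Qed.

(** The positivity argument of Tits, in the dual representation: the sign of
    [act w^-1 h0] at [s] in [T] tells whether [s] is a descent of [w]. *)
Section Positivity.
Variables (T : set V) (h0 : I -> R).
Hypothesis T_finite_label : forall x y, T x -> T y -> m x y <> None.
Hypothesis h0_pos : forall x, T x -> 0 < h0 (g x).

(** Pick a descent [t] of [w] and remove from [w] its part in the dihedral group
    of [s] and [t].  By induction the remaining element gives positive values at
    [s] and [t].  The removed word has length less than [k], for otherwise the
    braid relation would make [s] a descent; so the value at [s] is a combination
    of those two values with nonnegative Chebyshev coefficients. *)
Lemma act_pos w s : parabolic T w -> T s -> ~~ descent cox w s ->
  0 < act w^-1%g h0 (g s).
Proof.
have [N] := ubnP (len cox w); elim: N => // N IH in w s * => lw Tw Ts ds.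
have [w1|/eqP w1] := eqVneq w 1%g; first by rewrite w1 invg1 act1 h0_pos.
have [t Tt dt] := parabolic_descent cox Tw w1.
have ts : t <> s by move=> e; rewrite -e dt in ds.
have [k mts] : exists k, m t s = Some k.
  by case e : (m t s) => [k|]; [exists k | case: (T_finite_label Tt Ts)].
have k2 := cox_ge2 cox ts mts.
have [j [w' [Tw' dt' ds' le we]]] := peel Tt Ts Tw ds.
have j0 : (0 < j)%N.
  case: j le we => [|//] _; rewrite mul1g => /invg_inj e.
  by rewrite e (negbTE dt') in dt.
have jk : (j < k)%N.
  rewrite ltnNge; apply/negP => kj; case/negP: ds.
  have wsE : (w * val s)%g = ((val s * w^-1)^-1)%g by rewrite invgM invgK (genV cox).
  rewrite /descent wsE lenV we le -(subnKC kj) alt_add (alt_braid mts) -mulgA.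
  case: k k2 kj {mts} => // k k2 kj; rewrite [alt k.+1 s t]/= -mulgA (genKmul cox).
  apply: leq_trans (_ : (k + (j - k.+1) + len cox w' < _)%N); last by rewrite ltn_add2r addSn.
  rewrite ltnS -addnA; apply: leq_trans (lenM _ _ _) _; apply: leq_add (len_alt _ _ _) _.
  apply: leq_trans (lenM _ _ _) _; rewrite lenV leq_add2r.
  by case: ifP => _; apply: len_alt.
have IHw' u : T u -> ~~ descent cox w' u -> 0 < act w'^-1%g h0 (g u).
  by move=> Tu; apply: IH => //; move: lw; rewrite le; lia.
rewrite we actM act_alt; set h := act _ _.
have [pt ps] : 0 < h (g t) /\ 0 < h (g s) by split; apply: IHw'.
have cts := cE ts mts; have cst := cE' ts mts.
have pos : 0 < cheb (th k) j by case: (thP k2) => _ _; apply; rewrite j0.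
have pos' := cheb_ge0 (thP k2) jk.
have [e _] := altf_val (cii (g t)) (cii (g s)) cts cst h j.
have [e' _] := altf_val (cii (g s)) (cii (g t)) cst cts h j.
case: (odd j) e e' => e e'; rewrite (e, e') /alt_val.
  by rewrite ltr_wpDl ?mulr_gt0 ?mulr_ge0// ltW.
by rewrite ltr_wpDl ?mulr_gt0 ?mulr_ge0// ltW.
Qed.

Lemma act_faithful w : parabolic T w -> w <> 1%g -> exists2 s, T s & act w^-1%g h0 (g s) < 0.
Proof.
move=> Tw w1; have [t Tt dt] := parabolic_descent cox Tw w1.
exists t => //.
have Twt : parabolic T (w * val t)%g by apply: parabolicM => //; apply: parabolic_gen.
have := @act_pos (w * val t)%g t Twt Tt; rewrite descent_mul negbK => /(_ dt).
rewrite invgM (genV cox) actM actv /refl cii; set a := act _ _ _; lra.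
Qed.

End Positivity.

End Representation.

(** * Orders of products of two generators *)

Section Orders.
Variables (R : realType) (G : groupType) (V : set G) (m : V -> V -> option nat).
Hypothesis cox : coxeter_system m.

Lemma cheb_two j : cheb (2 : R) j = j%:R.
Proof.
have [//] : cheb (2 : R) j = j%:R /\ cheb (2 : R) j.+1 = j.+1%:R.
elim: j => [|j [IH1 IH2]]; first by rewrite cheb0 cheb1.
by split=> //; rewrite chebSS IH1 IH2 -[j.+2%:R]natr1 -[j.+1%:R]natr1; ring.
Qed.

(** In the reflection representation on functions of the generators, the orbit of
    the indicator function of [w] under [v w] is read off the Chebyshev sequence,
    which does not come back before step [k], and never does for the parameter
    [2] that stands for an infinite label. *)
Lemma order_gen_mul (v w : V) j : v <> w -> (0 < j)%N -> ((val v * val w) ^+ j)%g = 1%g ->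
  exists2 k, m v w = Some k & (k <= j)%N.
Proof.
move=> vw j0 e.
pose lbl o : R := if o is Some k then twocos R k else 2.
pose c (x y : V) : R := if x == y then 2 else - lbl (m x y).
have cii x : c x x = 2 by rewrite /c eqxx.
have cE x y k : x <> y -> m x y = Some k -> c x y = - twocos R k.
  by move=> /eqP/negbTE xy mxy; rewrite /c xy mxy.
have [act [act1 actM actv]] := reflection_action cox (@twocos_param R) cii cE.
pose h (x : V) : R := if x == w then 1 else 0.
have hv : h v = 0 by rewrite /h; case: eqP.
have hw : h w = 1 by rewrite /h eqxx.
have fix_ : altf c j.*2 v w h = h by rewrite -(act_pow act1 actM actv) e act1.
have cvw : c v w = - lbl (m v w) by rewrite /c; case: eqP.
have cwv : c w v = - lbl (m v w).
  by rewrite /c (cox_sym cox w v); case: eqP => // /esym.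
have [e1 _] := altf_val (cii v) (cii w) cvw cwv h j.*2.
have [_ e2] := altf_val (cii v) (cii w) cvw cwv h j.*2.-1.
have odd1 : odd j.*2.-1 by case: (j) j0 => // i _; rewrite doubleS /= odd_double.
move: e1 e2; rewrite odd_double odd1 prednK ?double_gt0// fix_ /alt_val hv hw.
rewrite prednK ?double_gt0// => e1 e2.
have {e1}u1 : cheb (lbl (m v w)) j.*2.+1 = 1 by rewrite e1; ring.
have {e2}u0 : cheb (lbl (m v w)) j.*2 = 0 by move: e2; lra.
case mvw : (m v w) u0 u1 => [k|] /= u0 u1.
  exists k => //; rewrite leqNgt; apply/negP => jk.
  have k2 := cox_ge2 cox vw mvw.
  by apply: (dihedral_order (twocos_param R k2) _ u0 u1); rewrite j0.
move: u0; rewrite cheb_two => /eqP; rewrite pnatr_eq0 double_eq0.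
by case: (j) j0.
Qed.

End Orders.

Lemma finite_orbit_order (G : groupType) (S : set G) (x : G) : finite_set S ->
  (forall j, S (x ^+ j)%g) -> exists2 j, (0 < j)%N & (x ^+ j)%g = 1%g.
Proof.
move=> fS Sx; apply: contrapT => h.
have inj : injective (fun j => (x ^+ j)%g).
  suff lt i j : (i < j)%N -> (x ^+ i)%g <> (x ^+ j)%g.
    by move=> i j e; case: (ltngtP i j) => // /lt; rewrite e.
  move=> ij e; apply: h; exists (j - i)%N; first by rewrite subn_gt0.
  by rewrite expgnFr 1?ltnW// e mulgV.
apply: infinite_nat; apply: (@sub_finite_set _ _ ((fun j => (x ^+ j)%g) @^-1` S)).
  by move=> j _; apply: Sx.
by apply: finite_preimage fS => i j _ _; apply: inj.
Qed.

Section FiniteParabolic.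
Variables (R : realType) (G : groupType) (V : set G) (m : V -> V -> option nat).
Hypothesis cox : coxeter_system m.

Lemma parabolic_label (T : set V) (v w : V) : T v -> T w -> finite_set (parabolic T) -> m v w <> None.
Proof.
move=> Tv Tw fT mvw.
have vw : v <> w by move=> e; rewrite e (cox_diag cox) in mvw.
have [|j j0 e] := finite_orbit_order (x := (val v * val w)%g) fT.
  elim=> [|j IH]; first exact: parabolic1.
  by rewrite expgS; apply: parabolicM => //; apply: parabolicM; apply: parabolic_gen.
by have [k] := order_gen_mul R cox vw j0 e; rewrite mvw.
Qed.

(** The powers of [v w], multiplied or not by [v], exhaust the subgroup. *)
Lemma dihedral_finite (v w : V) k : m v w = Some k -> (0 < k)%N ->
  finite_set (parabolic [set v; w]).
Proof.
move=> mvw k0; set x := (val v * val w)%g.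
have xk : (x ^+ k)%g = 1%g by exact: (cox_rel cox mvw).
have xmod i : (x ^+ i)%g = (x ^+ (i %% k))%g.
  by rewrite {1}(divn_eq i k) expgnDr mulnC expgnA xk expg1n mul1g.
have xV : (x^-1)%g = (x ^+ k.-1)%g.
  by apply: (mulgI x); rewrite mulgV -expgS prednK.
have vx : (val v * x = x ^+ k.-1 * val v)%g.
  by rewrite -xV /x invgM !(genV cox) -mulgA (genK cox) mulg1 (genKmul cox).
have vxi i : (val v * x ^+ i = x ^+ (k.-1 * i) * val v)%g.
  elim: i => [|i IH]; first by rewrite muln0 mulg1 mul1g.
  by rewrite expgS mulgA vx -mulgA IH mulgA -expgnDr mulnS.
have wE : (val w = x ^+ k.-1 * val v)%g.
  by rewrite -xV /x invgM !(genV cox) -mulgA (genK cox) mulg1.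
pose el (p : nat * bool) := (x ^+ p.1 * (if p.2 then val v else 1))%g.
have sub : parabolic [set v; w] `<=` range el.
  have stepv i b : exists q, (val v * el (i, b))%g = el q.
    exists ((k.-1 * i)%N, ~~ b); rewrite /el /= mulgA vxi -mulgA.
    by case: b; rewrite /= ?(genK cox) ?mulg1.
  move=> _ [s <-]; elim: s => [|u s IH] hs.
    by exists (0%N, false) => //; rewrite /el prd_nil mulg1.
  have [[i b] _ e] := IH (fun y ys => hs y (mem_behead (s := u :: s) ys)).
  rewrite prd_cons -e; have [q qe] := stepv i b.
  case: (hs u (mem_head _ _)) => ->; first by exists q.
  exists ((k.-1 + q.1)%N, q.2) => //.
  by rewrite wE -mulgA qe /el /= expgnDr mulgA.
apply: sub_finite_set sub _.
apply: (@sub_finite_set _ _ (el @` (`I_k `*` [set: bool]))).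
  move=> _ [[i b] _ <-]; exists ((i %% k)%N, b); last by rewrite /el /= -xmod.
  by split=> //=; rewrite ltn_mod.
by apply: finite_image; apply: finite_setX.
Qed.

Lemma K1_edgeP (v w : V) : K1_edge v w <-> v <> w /\ m v w <> None.
Proof.
have gen_sub : generated [set val v; val w] `<=` parabolic [set v; w].
  apply: smallest_sub.
    split; first by apply/asboolP; exact: parabolic1.
    move=> x y /asboolP px /asboolP py; apply/asboolP; apply: parabolicM => //.
    exact: (parabolicV cox py).
  by move=> _ [->|->]; apply: parabolic_gen; [left|right].
split=> [vw|[vw mvw]].
  split; first by move=> e; rewrite e in vw; apply: K1_edge_irr vw.
  case: vw => _ _ fin; apply: (@parabolic_label [set v; w]) => //; [by left|by right|].
  apply: sub_finite_set fin => _ [s <- hs] H [gH HS].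
  have HM x y : H x -> H y -> H (x * y)%g.
    by move=> /mem_set Hx /mem_set Hy; apply/set_mem/(group_closedM gH).
  elim: s hs => [|u s IH] hs; first by rewrite prd_nil; case: gH => /set_mem.
  rewrite prd_cons; apply: HM; last by apply: IH => y ys; apply: hs; rewrite inE ys orbT.
  by apply: HS; case: (hs u (mem_head _ _)) => ->; [left|right].
split.
- by move=> _ [->|->]; apply: set_valP.
- have vw' : val w == val v = false by apply/eqP => /val_inj/esym.
  apply/pcard_eqP; suff /Pbij[f] :
      set_bij [set val v; val w] `I_2 (fun x : G => (x != val v : nat)) by squash f.
  split.
  + by move=> x _ /=; case: (x != _).
  + by move=> x y; rewrite !inE => -[->|->] [->|->]; rewrite ?eqxx ?vw'.
  + move=> [|[|//]] _ /=; first by exists (val v); rewrite ?eqxx//; left.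
    by exists (val w); rewrite ?vw'//; right.
- have [k mk] : exists k, m v w = Some k by case: (m v w) mvw => // k _; exists k.
  apply: sub_finite_set gen_sub _; apply: (dihedral_finite mk).
  by rewrite (leq_trans _ (cox_ge2 cox vw mk)).
Qed.

End FiniteParabolic.


(** * Lattices of reals *)

Section Lattice.
Variables (R : realFieldType) (r : nat) (t : 'I_r -> R).

Definition lattice : set R := [set x | exists a : 'I_r -> int, x = \sum_i (a i)%:~R * t i].

Definition multiples (p : nat) : set R := [set x | exists2 y, lattice y & x = p%:R * y].

Lemma latticeB x y : lattice x -> lattice y -> lattice (x - y).
Proof.
move=> [a ->] [b ->]; exists (fun i => a i - b i); rewrite -sumrB.
by apply: eq_bigr => i _; rewrite intrB mulrBl.
Qed.

Lemma lattice0 : lattice 0.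
Proof. by exists (fun=> 0); rewrite big1// => i _; rewrite mul0r. Qed.

Lemma latticeD x y : lattice x -> lattice y -> lattice (x + y).
Proof. by move=> lx ly; rewrite -[y]opprK -[- y]sub0r; do !apply: latticeB => //; apply: lattice0. Qed.

Lemma latticeZ (a : int) x : lattice x -> lattice (a%:~R * x).
Proof.
move=> [b ->]; exists (fun i => a * b i); rewrite mulr_sumr.
by apply: eq_bigr => i _; rewrite intrM mulrA.
Qed.

Lemma lattice_gen i : lattice (t i).
Proof.
exists (fun j => (j == i)%:Z); rewrite (bigD1 i)//= eqxx mul1r big1 ?addr0// => j /negbTE ->.
by rewrite mul0r.
Qed.

Definition independent (B : {set 'I_r}) : bool :=
  `[< forall a : 'I_r -> int, \sum_(i in B) (a i)%:~R * t i = 0 -> forall i, i \in B -> a i = 0 >].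

(** If [B] is a maximal independent set of generators, then a nonzero multiple of
    each generator is a combination of [B]; [e] is the product of the multipliers. *)
Lemma lattice_coordinates : exists (B : {set 'I_r}) (e : int),
  [/\ independent B, e != 0
    & forall x, lattice x -> exists D : 'I_r -> int, e%:~R * x = \sum_(j in B) (D j)%:~R * t j].
Proof.
have [B maxB _] : {B : {set 'I_r} | maxset independent B & (finset.set0 \subset B)%SET}.
  by apply: maxset_exists; apply/asboolP => a _ i; rewrite inE.
have [indB maxP] := maxsetP maxB.
have dep i : exists (e : int) (C : 'I_r -> int),
    e != 0 /\ e%:~R * t i = \sum_(j in B) (C j)%:~R * t j.
  have [iB|iB] := boolP (i \in B).
    exists 1, (fun j => (j == i)%:Z); split=> //; rewrite (bigD1 i)//= eqxx big1 ?addr0//.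
    by move=> j /andP[_ /negbTE ->]; rewrite mul0r.
  have nind : ~~ independent (i |: B)%SET.
    apply/negP => ind; have := maxP _ ind (finset.subsetUr _ _) => e.
    by move: iB; rewrite -e !inE eqxx.
  move: nind => /asboolPn/existsNP[a /not_implyP[a0 /existsNP[k /not_implyP[kB ak]]]].
  move: a0; rewrite (big_setU1 _ iB) /= => a0.
  exists (a i), (fun j => - a j); split.
    apply/eqP => ai; apply: ak; move: kB; rewrite !inE => /orP[/eqP -> //|kB].
    move: a0; rewrite ai mul0r add0r => a0.
    by move/asboolP: indB; apply.
  rewrite -[LHS](addrK (\sum_(j in B) (a j)%:~R * t j)) a0 sub0r -sumrN.
  by apply: eq_bigr => j _; rewrite intrN mulNr.
have [e eP] := choice dep; have {eP}[C eC] := choice eP.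
exists B, (\prod_i e i); split=> //.
  by apply/prodf_neq0 => i _; case: (eC i).
move=> x [a ->].
exists (fun j => \sum_i a i * (\prod_(l | l != i) e l) * C i j).
rewrite mulr_sumr.
transitivity (\sum_i \sum_(j in B) (a i * (\prod_(l | l != i) e l) * C i j)%:~R * t j).
  apply: eq_bigr => i _; rewrite (bigD1 i)//=; have [_ eCi] := eC i.
  transitivity ((a i * (\prod_(l | l != i) e l))%:~R * ((e i)%:~R * t i)).
    by rewrite !intrM; ring.
  by rewrite eCi mulr_sumr; apply: eq_bigr => j _; rewrite !intrM !mulrA.
rewrite exchange_big; apply: eq_bigr => j _; rewrite -mulr_suml; congr (_ * _).
by rewrite (raddf_sum (intr : int -> R)).
Qed.

(** A nonzero coordinate of [e x] is not divisible by an integer that exceeds its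
    absolute value. *)
Lemma lattice_separated x : x != 0 -> exists2 p : nat, (0 < p)%N & ~ multiples p x.
Proof.
move=> x0; have [lx|nlx] := pselect (lattice x); last first.
  by exists 1%N => // -[y ly]; rewrite mul1r => xy; apply: nlx; rewrite xy.
have [B [e [/asboolP indB e0 coord]]] := lattice_coordinates.
have [D De] := coord x lx.
have [j jB Dj] : exists2 j, j \in B & D j != 0.
  apply: contrapT => h; have : e%:~R * x != 0 by rewrite mulf_neq0// intr_eq0.
  rewrite De big1 ?eqxx// => j jB; have [->|Dj] := eqVneq (D j) 0; first by rewrite mul0r.
  by case: h; exists j.
exists (`|D j|.+1)%N => // -[y ly xy].
have [D' De'] := coord y ly.
set p := (`|D j|.+1)%N in xy.
have : \sum_(i in B) (D i - p%:Z * D' i)%:~R * t i = 0.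
  have -> : \sum_(i in B) (D i - p%:Z * D' i)%:~R * t i =
     \sum_(i in B) (D i)%:~R * t i - p%:R * \sum_(i in B) (D' i)%:~R * t i.
    rewrite mulr_sumr -sumrB; apply: eq_bigr => i _.
    by rewrite intrB intrM mulrBl mulrA.
  by rewrite -De -De' xy; ring.
move=> /indB/(_ j jB); rewrite /p; set d := D j in Dj *; set d' := D' j.
have [->|d'0] := eqVneq d' 0; first by rewrite mulr0 subr0 => /eqP; rewrite (negbTE Dj).
move=> /eqP; rewrite subr_eq0 => /eqP dE.
have : (`|d| >= `|d|.+1)%N.
  by rewrite {2}dE abszM /= leq_pmulr// absz_gt0.
by rewrite ltnn.
Qed.

Lemma lattice_separated_seq (s : seq R) : exists2 p : nat, (0 < p)%N &
  forall x, x \in s -> x != 0 -> ~ multiples p x.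
Proof.
elim: s => [|x s [p p0 ps]]; first by exists 1%N.
have [->|x0] := eqVneq x 0.
  by exists p => // y; rewrite inE => /orP[/eqP ->|/ps//]; rewrite eqxx.
have [q q0 qx] := lattice_separated x0.
exists (p * q)%N; first by rewrite muln_gt0 p0.
have scale a b z : multiples (a * b) z -> multiples a z.
  by move=> [y ly ->]; exists (b%:R * y); rewrite ?natrM ?mulrA//; apply: (latticeZ b%:Z).
move=> y; rewrite inE => /orP[/eqP ->|ys] y0; first by rewrite mulnC => /scale.
by move=> /scale; apply: ps.
Qed.

End Lattice.

(** * A finite quotient that detects finite parabolic subgroups *)

Section Cosines.
Variables (R : realType) (N : nat).
Hypothesis N0 : (0 < N)%N.

(** By the product formula for cosines these numbers span a lattice stable under
    multiplication by each of them. *)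
Definition tcos (j : nat) : R := 2 * cos (j%:R * (pi / N%:R)).

Lemma tcos0 : tcos 0 = 2. Proof. by rewrite /tcos mul0r cos0 mulr1. Qed.

Lemma tcos_period j : tcos (j + N.*2) = tcos j.
Proof.
rewrite /tcos.
have -> : (j + N.*2)%:R * (pi / N%:R) = j%:R * (pi / N%:R) + pi *+ 2 :> R.
  have NR : N%:R != 0 :> R by rewrite pnatr_eq0 -lt0n.
  by rewrite -mul2n natrD natrM -mulr_natl; field.
by rewrite cosD2pi.
Qed.

Lemma tcos_mod j : tcos (j %% N.*2) = tcos j.
Proof.
rewrite [in RHS](divn_eq j N.*2) addnC; elim: (j %/ _)%N => [|q IH]; first by rewrite addn0.
by rewrite mulSn [(N.*2 + _)%N]addnC addnA tcos_period.
Qed.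

Lemma tcosM i j : tcos i * tcos j = tcos (i + j) + tcos (maxn i j - minn i j).
Proof.
have E : (i + j)%:R * (pi / N%:R) = i%:R * (pi / N%:R) + j%:R * (pi / N%:R) :> R.
  by rewrite natrD mulrDl.
rewrite /tcos E cosD.
have -> : cos ((maxn i j - minn i j)%:R * (pi / N%:R)) =
    cos (i%:R * (pi / N%:R) - j%:R * (pi / N%:R)) :> R.
  case: (leqP i j) => ij; first by rewrite natrB// mulrBl -[RHS]cosN opprB.
  by rewrite natrB ?mulrBl// ltnW.
by rewrite cosD cosN sinN; ring.
Qed.

Definition clattice : set R := lattice (fun j : 'I_N.*2 => tcos j).

Lemma clattice_tcos j : clattice (tcos j).
Proof.
have lt : (j %% N.*2 < N.*2)%N by rewrite ltn_mod double_gt0.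
by rewrite -tcos_mod; exact: (lattice_gen (fun j : 'I_N.*2 => tcos j) (Ordinal lt)).
Qed.

Lemma clatticeM i x : clattice x -> clattice (tcos i * x).
Proof.
move=> [a ->]; rewrite mulr_sumr.
apply: (big_ind clattice); [exact: lattice0 | exact: latticeD |] => j _.
by rewrite mulrCA; apply: latticeZ; rewrite tcosM; apply: latticeD; apply: clattice_tcos.
Qed.

End Cosines.

Section Kernel.
Variables (R : realType) (G : groupType) (V : set G) (m : V -> V -> option nat).
Hypothesis cox : coxeter_system m.
Variables (n : nat) (f : V -> 'I_n) (lab : 'I_n -> 'I_n -> nat).
Hypothesis lab_ok : forall v w k, v <> w -> m v w = Some k ->
  f v <> f w /\ lab (f v) (f w) = k.

(** A common multiple of the labels: [cos (pi / k)] is then of the form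
    [cos (j pi / N)] for each label [k]. *)
Definition lab_prod : nat := \prod_(ij : 'I_n * 'I_n) maxn 1 (lab ij.1 ij.2).
Local Notation N := lab_prod.

Lemma lab_prod_gt0 : (0 < N)%N.
Proof. by apply: prodn_gt0 => ij; rewrite leq_max. Qed.

Lemma lab_dvd i j : (0 < lab i j)%N -> (lab i j %| N)%N.
Proof.
move=> l0; rewrite /lab_prod (bigD1 (i, j))//= (maxn_idPr _)//.
exact: dvdn_mulr.
Qed.

(** The quotient is exact when the label is that of a pair of generators; on the
    remaining pairs of colours the coefficient is just some multiplier of the
    lattice. *)
Definition cartan (i j : 'I_n) : R := if i == j then 2 else - tcos R N (N %/ lab i j).

Lemma cartan_diag i : cartan i i = 2. Proof. by rewrite /cartan eqxx. Qed.

Lemma cartan_label v w k : v <> w -> m v w = Some k -> cartan (f v) (f w) = - twocos R k.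
Proof.
move=> vw mvw; have [fvw lk] := lab_ok vw mvw; have k2 := cox_ge2 cox vw mvw.
rewrite /cartan; case: eqP => // _; congr (- _); rewrite lk /tcos /twocos; congr (2 * cos _).
have dv : (k %| N)%N by rewrite -lk; apply: lab_dvd; rewrite lk; apply: ltnW k2.
have k0 : k%:R != 0 :> R by rewrite pnatr_eq0; lia.
have q0 : (N %/ k)%:R != 0 :> R.
  rewrite pnatr_eq0 -lt0n divn_gt0; last exact: ltnW k2.
  exact: dvdn_leq lab_prod_gt0 dv.
move: q0; rewrite -[X in _ / X%:R](divnK dv) natrM; set q := (_ %/ _)%N => q0; field.
by rewrite k0.
Qed.

Local Notation L := (@clattice R N).
Local Notation F := ('I_n -> R).

Definition lfun : set F := [set h | forall i, L (h i)].

Lemma refl_lfun i h : lfun h -> lfun (refl cartan i h).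
Proof.
move=> lh j; apply: latticeB; first exact: lh.
rewrite /cartan; case: (i == j); first exact: (latticeZ 2 (lh i)).
by rewrite mulNr -sub0r; apply: latticeB; [apply: lattice0 | apply: (clatticeM lab_prod_gt0)].
Qed.

Variable act : G -> F -> F.
Hypothesis act1 : forall h, act 1%g h = h.
Hypothesis actM : forall x y h, act (x * y)%g h = act x (act y h).
Hypothesis actv : forall (v : V) h, act (val v) h = refl cartan (f v) h.

Lemma act_lfun g h : lfun h -> lfun (act g h).
Proof.
move=> lh; have [s <-] := word_of cox g; elim: s => [|v s IH]; first by rewrite prd_nil act1.
by rewrite prd_cons actM actv; apply: refl_lfun.
Qed.

Lemma act_linear g (a : R) h h' :
  act g (fun i => h i + a * h' i) = fun i => act g h i + a * act g h' i.
Proof.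
have [s <-] := word_of cox g; elim: s => [|v s IH]; first by rewrite prd_nil !act1.
rewrite prd_cons !actM IH !actv; apply/funext => i; rewrite /refl; ring.
Qed.

Lemma act_invK g h : act g^-1%g (act g h) = h.
Proof. by rewrite -actM mulVg act1. Qed.

Section Modulus.
Variable p : nat.
Hypothesis p0 : (0 < p)%N.

Definition pcongr (h h' : F) : Prop := exists2 y, lfun y & h = fun i => h' i + p%:R * y i.

Lemma pcongr_act g h h' : pcongr h h' -> pcongr (act g h) (act g h').
Proof.
move=> [y ly ->]; exists (act g y); first exact: act_lfun.
by rewrite act_linear.
Qed.

Lemma pcongr_refl h : pcongr h h.
Proof.
exists (fun=> 0); first by move=> i; apply: lattice0.
by apply/funext => i; rewrite mulr0 addr0.
Qed.

Lemma pcongr_sym h h' : pcongr h h' -> pcongr h' h.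
Proof.
move=> [y ly ->]; exists (fun i => 0 - y i); first by move=> i; apply: latticeB; [apply: lattice0 | apply: ly].
by apply/funext => i; ring.
Qed.

Lemma pcongr_trans h h' h'' : pcongr h h' -> pcongr h' h'' -> pcongr h h''.
Proof.
move=> [y ly ->] [y' ly' ->]; exists (fun i => y' i + y i); first by move=> i; apply: latticeD; [apply: ly' | apply: ly].
by apply/funext => i; ring.
Qed.

Definition congruence_pred : pred G :=
  fun g => `[< forall h, lfun h -> pcongr (act g h) h >].

Lemma congruence_closed : group_closed congruence_pred.
Proof.
split; first by apply/asboolP => h _; rewrite act1; apply: pcongr_refl.
move=> x y /asboolP hx /asboolP hy; apply/asboolP => h lh; rewrite actM.
have ly : lfun (act y^-1%g h) by apply: act_lfun.
apply: pcongr_trans (hx _ ly) _; apply: pcongr_sym.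
by have := hy _ ly; rewrite -actM mulgV act1.
Qed.

Definition congruence_subgroup : groupClosed G :=
  HB.pack congruence_pred
    (isInvClosed.Build G congruence_pred (group_closedV congruence_closed))
    (isMul1Closed.Build G congruence_pred congruence_closed.1)
    (isMulClosed.Build G congruence_pred (group_closedM congruence_closed)).

Lemma congruenceP g :
  reflect (forall h, lfun h -> pcongr (act g h) h) (g \in congruence_subgroup).
Proof. exact: asboolP. Qed.

Lemma congruence_normal g w : g \in congruence_subgroup ->
  (w^-1 * g * w)%g \in congruence_subgroup.
Proof.
move=> /congruenceP gK; apply/congruenceP => h lh; rewrite !actM.
have := pcongr_act w^-1%g (gK _ (act_lfun w lh)).
by rewrite act_invK.
Qed.

Lemma finite_range_factor (A B : Type) (X : finType) (F' : A -> B) (th : A -> X) :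
  (forall a b, th a = th b -> F' a = F' b) -> finite_set (range F').
Proof.
move=> thF; have [[a0 _]|nA] := pselect (exists a : A, True); last first.
  apply: (@sub_finite_set _ _ set0) => // y [a _ _].
  by case: nA; exists a.
pose back (x : X) := if pselect (exists a, th a = x) is left e then F' (projT1 (cid e)) else F' a0.
apply: (@sub_finite_set _ _ (back @` [set: X])); last exact/finite_image/finite_finset.
move=> _ [a _ <-]; exists (th a) => //; rewrite /back.
case: pselect => [e|[]]; last by exists a.
by apply: thF; case: cid.
Qed.

Definition lgen (q : 'I_n * 'I_N.*2) : F := fun i => if i == q.1 then tcos R N q.2 else 0.

Lemma lfun_ind (S : set F) : S (fun=> 0) ->
  (forall h (a : int) q, S h -> S (fun i => h i + a%:~R * lgen q i)) ->
  forall h, lfun h -> S h.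
Proof.
move=> S0 Sadd h lh; have [a aP] := choice lh.
have -> : h = fun i => \sum_(q : 'I_n * 'I_N.*2) (a q.1 q.2)%:~R * lgen q i.
  apply/funext => i; rewrite aP -(pair_big xpredT xpredT (fun l j => (a l j)%:~R * lgen (l, j) i)) /=.
  rewrite [RHS](bigD1 i)//= [X in _ + X]big1 ?addr0 => [|l li]; last first.
    by rewrite big1// => j _; rewrite /lgen /= eq_sym (negbTE li) mulr0.
  by apply: eq_bigr => j _; rewrite /lgen eqxx.
elim: (index_enum _) => [|q e IH].
  by rewrite (_ : (fun i => _) = fun=> 0)//; apply/funext => i; rewrite big_nil.
have := Sadd _ (a q.1 q.2) q IH.
by congr S; apply/funext => i; rewrite big_cons addrC.
Qed.

(** The coset of [g] is determined by the values of [g] on the finitely many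
    generators [lgen q], modulo [p]. *)
Lemma congruence_finite_index : finite_index [set` congruence_subgroup].
Proof.
have p1 : p.-1.+1 = p by rewrite prednK.
have lg q : lfun (lgen q).
  move=> i; rewrite /lgen; case: (i == _); last exact: lattice0.
  exact: (clattice_tcos R lab_prod_gt0).
have co g q i : exists a : 'I_N.*2 -> int, act g (lgen q) i = \sum_j (a j)%:~R * tcos R N j.
  exact: (act_lfun g (lg q)).
pose coef g q i := projT1 (cid (co g q i)).
have coefE g q i : act g (lgen q) i = \sum_j (coef g q i j)%:~R * tcos R N j.
  by rewrite /coef; case: cid.
pose th (g : G) : {ffun ('I_n * 'I_N.*2) * 'I_n * 'I_N.*2 -> 'I_p.-1.+1} :=
  [ffun x => inord `|(coef g x.1.1 x.1.2 x.2 %% p)%Z|%N].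
apply: (@finite_range_factor _ _ _ _ th) => x y xy.
have cong q i j : exists d : int, coef x q i j = coef y q i j + p%:Z * d.
  have := congr1 (fun F' : {ffun _ -> _} => nat_of_ord (F' ((q, i), j))) xy.
  have bound (c : int) : (`|(c %% p)%Z| < p.-1.+1)%N.
    rewrite p1 -ltz_nat gez0_abs ?modz_ge0 ?ltz_pmod//; lia.
  rewrite !ffunE !inordK ?bound// => e.
  have {}e : (coef x q i j %% p)%Z = (coef y q i j %% p)%Z.
    by rewrite -[LHS]gez0_abs ?modz_ge0 ?e ?gez0_abs ?modz_ge0//; lia.
  exists ((coef x q i j %/ p)%Z - (coef y q i j %/ p)%Z).
  rewrite {1}(divz_eq (coef x q i j) p) {1}(divz_eq (coef y q i j) p) e; ring.
have gens q : pcongr (act x (lgen q)) (act y (lgen q)).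
  have [d' dP'] := @choice _ _ (fun (ij : 'I_n * 'I_N.*2) d => _) (fun ij => cong q ij.1 ij.2).
  pose d i j := d' (i, j); have dP i j := dP' (i, j).
  exists (fun i => \sum_j (d i j)%:~R * tcos R N j); first by move=> i; exists (d i).
  apply/funext => i; rewrite !coefE mulr_sumr -big_split; apply: eq_bigr => j _ /=.
  by rewrite dP intrD intrM; ring.
have all_ h : lfun h -> pcongr (act x h) (act y h).
  move: h; apply: (@lfun_ind (fun h => pcongr (act x h) (act y h))) => [|h a q [u lu hu]].
    have z g : act g (fun=> 0) = fun=> 0.
      have := act_linear g (-1) (fun=> 0) (fun=> 0).
      rewrite (_ : (fun _ : 'I_n => _) = fun=> 0); last by apply/funext => i; ring.
      by move=> e; rewrite {1}e; apply/funext => i; ring.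
    by rewrite !z; apply: pcongr_refl.
  have [u' lu' qu'] := gens q; rewrite !act_linear hu qu'.
  exists (fun i => u i + a%:~R * u' i); first by move=> i; apply: latticeD; [apply: lu | apply: latticeZ; apply: lu'].
  by apply/funext => i; ring.
have mem_quot : (y^-1 * x)%g \in congruence_subgroup.
  apply/congruenceP => h lh; rewrite actM.
  by have := pcongr_act y^-1%g (all_ h lh); rewrite act_invK.
have mulK a b : a \in congruence_subgroup -> b \in congruence_subgroup ->
    (a * b)%g \in congruence_subgroup by move=> aK bK; rewrite gpredM.
apply/seteqP; split=> _ [k kK <-] /=.
  by exists (y^-1 * x * k)%g; [apply: mulK | rewrite !mulgA mulgV mul1g].
exists (x^-1 * y * k)%g; last by rewrite !mulgA mulgV mul1g.
apply: mulK => //; have := gpredV congruence_subgroup (y^-1 * x)%g.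
by rewrite mem_quot invgM invgK.
Qed.

End Modulus.

End Kernel.

(** The modulus [p] must separate [h i] from [2] for all the functions [h] in the
    finite orbits of the constant function [2] under groups generated by
    reflections of colours; there are finitely many such groups, although there
    may be infinitely many sets [T]. *)
Theorem detecting_subgroup (R : realType) (G : groupType) (V : set G)
    (m : V -> V -> option nat) (cox : coxeter_system m) (n : nat) (f : V -> 'I_n)
    (lab : 'I_n -> 'I_n -> nat) :
  (forall v w k, v <> w -> m v w = Some k -> f v <> f w /\ lab (f v) (f w) = k) ->
  exists K : groupClosed G, [/\ finite_index [set` K],
    forall h w, h \in K -> (w^-1 * h * w)%g \in K
    & forall (T : set V) u, finite_set (parabolic T) -> parabolic T u ->
        u \in K -> u = 1%g].
Proof.
move=> lab_ok.
have [act [act1 actM actv]] := reflection_action cox (@twocos_param R)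
  (cartan_diag R lab) (cartan_label R cox lab_ok).
pose c := cartan R lab; pose h0 (i : 'I_n) : R := 2.
pose O (J : {set 'I_n}) := [set h : 'I_n -> R |
  exists2 s : seq 'I_n, (forall i, i \in s -> i \in J) & h = foldr (fun i => refl c i) h0 s].
pose B := \bigcup_(J in [set J | finite_set (O J)]) \bigcup_(i in [set: 'I_n])
  ((fun h : 'I_n -> R => h i - 2) @` O J).
have finB : finite_set B.
  apply: bigcup_finite; first exact: finite_finset.
  move=> J fJ; apply: bigcup_finite; first exact: finite_finset.
  by move=> i _; apply: finite_image.
have [s sB] := (finite_seqP B).1 finB.
have [p p0 sep] := lattice_separated_seq (fun j : 'I_(lab_prod lab).*2 => tcos R (lab_prod lab) j) s.
exists (congruence_subgroup cox act1 actM actv p); split.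
- exact: congruence_finite_index.
- by move=> h w; apply: congruence_normal.
move=> T u fT Tu /congruenceP uK; apply: contrapT => u1.
have uV1 : u^-1%g <> 1%g by move=> e; apply: u1; rewrite -[u]invgK e invg1.
have [||s' Ts'] := @act_faithful _ _ _ cox _ _ _ _ _ (@twocos_param R)
  (cartan_diag R lab) (cartan_label R cox lab_ok) act act1 actM actv T h0 _ _ _ (parabolicV cox Tu) uV1.
- by move=> x y Tx Ty; apply: (parabolic_label R cox Tx Ty fT).
- by move=> x _; rewrite /h0; lra.
rewrite invgK => neg.
have l0 : lfun lab h0.
  by move=> i; rewrite /h0 -(tcos0 R (lab_prod lab)); apply: (clattice_tcos R (lab_prod_gt0 lab)).
have [y ly /(congr1 (fun h => h (f s')))] := uK _ l0; rewrite {2}/h0 => e.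
pose J : {set 'I_n} := [set i | `[< exists2 v, T v & f v = i >]]%SET.
have OJ : O J `<=` (fun w => act w h0) @` parabolic T.
  move=> _ [q qJ ->]; elim: q qJ => [|i q IH] qJ.
    by exists 1%g; [apply: parabolic1 | rewrite act1].
  have [w Tw ew] := IH (fun j jq => qJ j (mem_behead (s := i :: q) jq)).
  have := qJ i (mem_head _ _); rewrite inE => /asboolP[v Tv fv].
  exists (val v * w)%g; first by apply: parabolicM => //; apply: parabolic_gen.
  by rewrite actM actv ew /= fv.
have Bx : B (act u h0 (f s') - 2).
  exists J; first by apply: sub_finite_set OJ _; apply: finite_image.
  exists (f s') => //; exists (act u h0) => //.
  case: Tu => q <- qT; exists (map f q).
    move=> i /mapP[v vq ->]; rewrite inE; apply/asboolP; exists v => //; exact: qT.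
  elim: q {qT uK uV1 u1 neg e} => [|v q IH]; first by rewrite prd_nil act1.
  by rewrite prd_cons actM IH actv.
rewrite sB in Bx; apply: (sep _ Bx); first by apply/eqP; lra.
by exists (y (f s')); [apply: ly | rewrite e; ring].
Qed.


(** * Finite cohomological dimension forbids torsion *)

Section Tate.
Variables (H : groupType) (c : H) (k : nat).
Hypotheses (k0 : (0 < k)%N) (ck : (c ^+ k)%g = 1%g)
  (k_min : forall j, (0 < j < k)%N -> (c ^+ j)%g <> 1%g).

Definition norm (M : gmodule H) (x : M) : M := \sum_(i < k) gm_act M (c ^+ i)%g x.

Lemma normB (M : gmodule H) (x y : M) : norm (x - y) = norm x - norm y.
Proof. by rewrite /norm -sumrB; apply: eq_bigr => i _; rewrite raddfB. Qed.

Lemma norm_hom (M N : gmodule H) (f : gm_hom M N) x : f (norm x) = norm (f x).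
Proof. by rewrite /norm raddf_sum; apply: eq_bigr => i _; rewrite gm_funE. Qed.

Lemma norm_act (M : gmodule H) (x : M) : norm (gm_act M c x) = norm x.
Proof.
rewrite /norm -[k](prednK k0) big_ord_recr [in RHS]big_ord_recl /= addrC.
rewrite -!gm_actM -expgSr (prednK k0) ck expg0; congr (_ + _).
by apply: eq_bigr => i _; rewrite -gm_actM -expgSr.
Qed.

Lemma act_norm (M : gmodule H) (x : M) : gm_act M c (norm x) = norm x.
Proof.
rewrite -[RHS]norm_act /norm raddf_sum; apply: eq_bigr => i _.
by rewrite -!gm_actM -expgS -expgSr.
Qed.

(** Vanishing of the Tate cohomology groups of the subgroup generated by [c],
    with coefficients in the invariant subgroup [Z]. *)
Definition tate_trivial (M : gmodule H) (Z : set M) : Prop :=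
  (forall x, Z x -> gm_act M c x = x -> exists2 y, Z y & x = norm y) /\
  (forall x, Z x -> norm x = 0 -> exists2 y, Z y & x = gm_act M c y - y).

(** Half of the long exact sequence: vanishing for the module and for the kernel
    of a homomorphism gives vanishing for the image. *)
Lemma tate_image (M N : gmodule H) (f : gm_hom M N) :
  tate_trivial [set: M] -> tate_trivial [set x | f x = 0] ->
  tate_trivial (range f).
Proof.
move=> [M1 M2] [K1 K2]; split=> _ [a _ <-].
  move=> fa; have [||b fb cb] := K2 (gm_act M c a - a).
  - by rewrite /= raddfB gm_funE fa subrr.
  - by rewrite normB norm_act subrr.
  have [//||y _ ay] := M1 (a - b).
    have : gm_act M c a - a - (gm_act M c b - b) = 0 by rewrite cb subrr.
    move=> /eqP; rewrite raddfB /= addrAC opprB addrA [_ + b]addrC subr_eq0.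
    rewrite -subr_eq0 => /eqP e; apply/eqP; rewrite -subr_eq0 -[X in _ == X]e; apply/eqP.
    by rewrite opprB !addrA; congr (_ - _); rewrite addrC !addrA.
  exists (f y); first by exists y.
  by rewrite -norm_hom -ay raddfB fb subr0.
move=> Na; have [||b fb Nb] := K1 (norm a).
- by rewrite /= norm_hom.
- exact: act_norm.
have [//||y _ ay] := M2 (a - b); first by rewrite normB Nb subrr.
exists (f y); first by exists y.
by rewrite -gm_funE -raddfB -ay raddfB fb subr0.
Qed.

Section Induced.
Variable P : gmodule H.

(** The module induced from the trivial subgroup, of which a projective module is
    a direct summand. *)
Definition ind_closed : zmodClosed (H -> P).
Proof.
apply: (@zclosed (H -> P) [set F | fin_supp F]).
  by apply/fin_suppP; exists [::] => // i; rewrite eqxx.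
by move=> x y; apply: fin_suppB.
Defined.

Definition ind := subzmod ind_closed.

Lemma ind_fin (F : ind) : fin_supp (subzmod_val F).
Proof. exact: elimT (zclosedP _ _ _) (subzmod_valP F). Qed.

Definition mk_ind (F : H -> P) (fF : fin_supp F) : ind :=
  SubZmod (introT (zclosedP _ _ F) fF).

Lemma ind_shift_fin g (F : ind) : fin_supp (fun x => subzmod_val F (g^-1 * x)%g).
Proof.
apply: (fin_supp_inj (h := fun x => (g^-1 * x)%g) (h' := fun x => (g * x)%g) _ (ind_fin F)).
by move=> x; rewrite mulVKg.
Qed.

Definition ind_act_fun g (F : ind) : ind := mk_ind (ind_shift_fin g F).

Lemma ind_ext (F F' : ind) : subzmod_val F = subzmod_val F' -> F = F'.
Proof. exact: val_inj. Qed.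

Lemma ind_act_additive g : zmod_morphism (ind_act_fun g).
Proof. by move=> x y; apply: ind_ext. Qed.

Definition ind_act g : {additive ind -> ind} := additive_of (ind_act_additive g).

Lemma ind_act1 F : ind_act 1%g F = F.
Proof. by apply: ind_ext; apply/funext => x /=; rewrite invg1 mul1g. Qed.

Lemma ind_actM g h F : ind_act (g * h)%g F = ind_act g (ind_act h F).
Proof. by apply: ind_ext; apply/funext => x /=; rewrite invgM mulgA. Qed.

Definition ind_gmod : gmodule H := GModule ind_act1 ind_actM.

Definition ind_sum_fun (F : ind) : P := fsum (fun x => gm_act P x (subzmod_val F x)).

Lemma ind_sum_fin (F : ind) : fin_supp (fun x => gm_act P x (subzmod_val F x)).
Proof.
have /fin_suppP[r ur rF] := ind_fin F; apply/fin_suppP; exists r => // x nz.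
by apply: rF; apply: contraNneq nz => ->; rewrite raddf0.
Qed.

Lemma ind_sum_additive : zmod_morphism ind_sum_fun.
Proof.
move=> F F'; rewrite /ind_sum_fun -fsumB; try exact: ind_sum_fin.
by apply: eq_fsum => x /=; rewrite -raddfB.
Qed.

Lemma ind_sum_equivariant g (F : ind) :
  additive_of ind_sum_additive (ind_act g F) = gm_act P g (additive_of ind_sum_additive F).
Proof.
rewrite /= /ind_sum_fun fsum_morph; last exact: ind_sum_fin.
rewrite -[LHS](@fsum_reindex _ _ _ (fun x => (g * x)%g) (fun x => (g^-1 * x)%g)).
- by apply: eq_fsum => x /=; rewrite gm_actM mulKg.
- by move=> x; rewrite mulKg.
- by move=> x; rewrite mulVKg.
Qed.

Definition ind_sum : gm_hom ind_gmod P :=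
  @GmHom H ind_gmod P _ ind_sum_equivariant.

Lemma ind_sum_surjective : gm_surjective ind_sum.
Proof.
move=> y; pose F (x : H) : P := if x == 1%g then y else 0.
have fF : fin_supp F.
  apply/fin_suppP; exists [:: 1%g] => // x; rewrite /F inE.
  by case: (x == 1%g) => //; rewrite eqxx.
exists (mk_ind fF); rewrite /= /ind_sum_fun (@fsum1 _ _ _ 1%g) => [|x x1].
  by rewrite /= /F eqxx gm_act1.
by rewrite /= /F (negbTE x1) raddf0.
Qed.

Definition gm_id : gm_hom P P := @GmHom H P P idfun (fun _ _ => erefl).

Hypothesis projP : gm_projective P.

Definition orb (y : H) : set H := [set z | exists i, z = (c ^+ i * y)%g].

Definition orb_rep (y : H) : Prop := y = xget 1%g (orb y).

Lemma expc_eq1 a : (c ^+ a)%g = 1%g <-> (k %| a)%N.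
Proof.
rewrite {1}(divn_eq a k) expgnDr mulnC expgnA ck expg1n mul1g /dvdn.
split=> [e|/eqP ->//]; apply: contrapT => /negP a0.
by apply: (@k_min (a %% k)%N) e; rewrite lt0n a0 ltn_mod.
Qed.

Lemma orb_act i y : orb (c ^+ i * y)%g = orb y.
Proof.
apply/seteqP; split=> _ [j ->].
  by exists (j + i)%N; rewrite mulgA expgnDr.
exists (j + (k * i - i))%N; rewrite mulgA -expgnDr -addnA subnK ?leq_pmull//.
by rewrite expgnDr expgnA ck expg1n mulg1.
Qed.

Lemma orb_rep_sum (z : H) : (\sum_(i < k) `[< orb_rep (c^-1 ^+ i * z)%g >])%N = 1%N.
Proof.
have cV i : (c^-1 ^+ i)%g = (c ^+ (k * i - i))%g.
  by rewrite expgnFr ?leq_pmull// expgnA ck expg1n mul1g expVgn.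
have [j jE] : orb z (xget 1%g (orb z)).
  by apply: xgetPex; exists z; exists 0%N; rewrite mul1g.
have repE i : orb_rep (c^-1 ^+ i * z)%g <-> (c ^+ (i + j))%g = 1%g.
  rewrite /orb_rep cV orb_act jE -cV expVgn; split=> [/mulIg e|e].
    by rewrite expgnDr -e mulgV.
  by congr (_ * _)%g; apply: mulg1_eq; rewrite -expgnDr.
have lt0 : ((k - j %% k) %% k < k)%N by rewrite ltn_mod.
have dv0 : ((k - j %% k) %% k + j = 0 %[mod k])%N.
  by rewrite modnDml -modnDmr subnK ?modnn ?mod0n// ltnW// ltn_mod.
rewrite (bigD1 (Ordinal lt0))//= asboolT; last first.
  by apply/repE/expc_eq1; rewrite /dvdn dv0 mod0n.
rewrite big1 ?addn0// => i ne; rewrite asboolF// => /repE/expc_eq1 ci; case/negP: ne.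
have : (i + j == (k - j %% k) %% k + j %[mod k])%N by rewrite dv0 mod0n.
by rewrite eqn_modDr modn_mod modn_small// => /eqP e; apply/eqP/val_inj.
Qed.

Definition trace_part (s : P -> ind) (x : P) : P :=
  fsum (fun y => if `[< orb_rep y >] then gm_act P y (subzmod_val (s x) y) else 0).

(** Factor the identity of [P] through the induced module, and restrict functions
    to a transversal of the powers of [c] in between: the translates of the
    transversal cover the group once. *)
Lemma projective_averaging : exists theta : {additive P -> P},
  forall x, x = \sum_(i < k) gm_act P (c ^+ i)%g (theta (gm_act P (c^-1 ^+ i)%g x)).
Proof.
have [s sK] := projP gm_id ind_sum_surjective.
have fin x : fin_supp (fun y => if `[< orb_rep y >] then gm_act P y (subzmod_val (s x) y) else 0).
  have /fin_suppP[r ur rF] := ind_sum_fin (s x); apply/fin_suppP; exists r => // y nz.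
  by apply: rF; move: nz; case: ifP => //; rewrite eqxx.
have thB : zmod_morphism (trace_part s).
  move=> x y; rewrite /trace_part -fsumB//; apply: eq_fsum => z.
  by case: ifP => _; [rewrite -raddfB; congr (gm_act P z _); rewrite raddfB | rewrite subr0].
exists (additive_of thB) => x.
have step i : gm_act P (c ^+ i)%g (trace_part s (gm_act P (c^-1 ^+ i)%g x)) =
    fsum (fun z => if `[< orb_rep (c^-1 ^+ i * z)%g >] then gm_act P z (subzmod_val (s x) z) else 0).
  rewrite /trace_part fsum_morph//.
  rewrite -[RHS](@fsum_reindex _ _ _ (fun z => (c ^+ i * z)%g) (fun z => (c^-1 ^+ i * z)%g)).
  - apply: eq_fsum => z; rewrite expVgn mulKg; case: ifP => _; last by rewrite raddf0.
    by rewrite gm_funE -gm_actM /= invgK.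
  - by move=> z; rewrite expVgn mulKg.
  - by move=> z; rewrite expVgn mulVKg.
apply: esym; transitivity (\sum_(i < k) fsum (fun z =>
    if `[< orb_rep (c^-1 ^+ i * z)%g >] then gm_act P z (subzmod_val (s x) z) else 0)).
  by apply: eq_bigr => i _; apply: step.
apply: esym; have /fin_suppP[r ur rF] := ind_sum_fin (s x).
rewrite -[LHS]sK -[LHS]/(ind_sum_fun (s x)) /ind_sum_fun (fsumE ur rF).
transitivity (\sum_(i < k) \sum_(z <- r)
    (if `[< orb_rep (c^-1 ^+ i * z)%g >] then gm_act P z (subzmod_val (s x) z) else 0)).
  rewrite exchange_big; apply: eq_bigr => z _.
  rewrite -[LHS]mulr1n -(orb_rep_sum z) -sumrMnr; apply: eq_bigr => i _.
  by case: ifP; rewrite ?mulr1n ?mulr0n.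
apply: eq_bigr => i _; rewrite (fsumE ur)// => z nz.
by apply: rF; move: nz; case: ifP => //; rewrite eqxx.
Qed.

(** If [x] is fixed by [c], the averaging formula reads [x = norm (theta x)].  If
    [norm x = 0], the images under [theta] add up to [0], so that each can be
    subtracted from its translate by a power of [c]. *)
Lemma projective_tate : tate_trivial [set: P].
Proof.
have [theta thE] := projective_averaging.
have cV i : (c^-1 ^+ i)%g = (c ^+ (k * i - i))%g.
  by rewrite expgnFr ?leq_pmull// expgnA ck expg1n mul1g expVgn.
have norm_inv x : norm x = \sum_(i < k) gm_act P (c^-1 ^+ i)%g x.
  rewrite -norm_act [RHS](reindex_inj rev_ord_inj); apply: eq_bigr => i _.
  rewrite -gm_actM -expgSr expVgn; congr (gm_act P _ x); apply/esym/mulg1_eq.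
  by rewrite -expgnDr subnK.
split=> x _ cx.
  have cix i : gm_act P (c ^+ i)%g x = x.
    by elim: i => [|i IH]; rewrite ?gm_act1// expgS gm_actM IH.
  exists (theta x) => //; rewrite {1}[x]thE; apply: eq_bigr => i _.
  by rewrite cV cix.
have diff i z : exists y, gm_act P (c ^+ i)%g z - z = gm_act P c y - y.
  elim: i => [|i [y e]]; first by exists 0; rewrite gm_act1 raddf0 !subrr.
  exists (y + gm_act P (c ^+ i)%g z); rewrite raddfD -gm_actM -expgS opprD addrACA -e.
  by rewrite addrC addrA subrK.
have [Y YE] := choice (fun i : 'I_k => diff i (theta (gm_act P (c^-1 ^+ i)%g x))).
exists (\sum_i Y i) => //; rewrite raddf_sum -sumrB (eq_bigr _ (fun i _ => esym (YE i))).
by rewrite sumrB -thE -raddf_sum -norm_inv cx raddf0 subr0.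
Qed.

End Induced.
End Tate.

(** On the trivial module the norm is multiplication by [k], and [1] would have to
    be a multiple of [k]. *)
Lemma finite_cd_order_le1 (H : groupType) (c : H) k :
  (0 < k)%N -> (c ^+ k)%g = 1%g -> (forall j, (0 < j < k)%N -> (c ^+ j)%g <> 1%g) ->
  finite_cd H -> k = 1%N.
Proof.
move=> k0 ck kmin [n [P [d [e [proj surj ex0 ex big]]]]].
have TP i : tate_trivial c k [set: P i] by apply: projective_tate.
have ker j i : (n <= i + j)%N -> tate_trivial c k [set x | d i x = 0].
  elim: j i => [|j IH] i nij.
    have z (x : P i.+1) : x = 0 by apply: big; rewrite ltnS -[i]addn0.
    by split=> x _ _; (exists 0; first exact: raddf0); rewrite (z x); apply/esym/z.
  have -> : [set x | d i x = 0] = range (d i.+1).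
    apply/seteqP; split=> [x /= /ex[y <-]|_ [y _ <-]]; first by exists y.
    by apply/ex; exists y.
  by apply: tate_image => //; apply: IH; rewrite addSnnS.
have ker_e : tate_trivial c k [set x | e x = 0].
  have -> : [set x | e x = 0] = range (d 0%N).
    apply/seteqP; split=> [x /= /ex0[y <-]|_ [y _ <-]]; first by exists y.
    by apply/ex0; exists y.
  by apply: tate_image => //; apply: (ker n); rewrite add0n.
have [Z1 _] := tate_image k0 ck (TP 0%N) ker_e.
have [u u1] := surj (1%:Z : gm_trivial H).
have [||y _] := Z1 (1%:Z : gm_trivial H) => //; first by exists u.
rewrite /norm /= sumr_const card_ord -mulr_natl => /esym/eqP.
move=> /eqP/(congr1 absz); rewrite abszM /= natz absz_nat => /eqP.
by rewrite muln_eq1 => /andP[/eqP].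
Qed.

Lemma finite_cd_torsion_free (H : groupType) (c : H) j :
  finite_cd H -> (0 < j)%N -> (c ^+ j)%g = 1%g -> c = 1%g.
Proof.
move=> fcd j0 cj.
have ex_ : exists k, (0 < k)%N && ((c ^+ k)%g == 1%g) by exists j; rewrite j0 cj eqxx.
case: (ex_minnP ex_) => k /andP[k0 /eqP ck] kmin.
suff k1 : k = 1%N by rewrite k1 in ck.
apply: (finite_cd_order_le1 k0 ck _ fcd) => i /andP[i0 ik] ci.
by have := kmin i; rewrite i0 ci eqxx leqNgt ik => /(_ isT).
Qed.


Local Close Scope ring_scope.

(** * Graphs of involutions *)

Section InvolutionGraph.
Variable N : nat.
Local Notation D := {ffun 'I_N -> 'I_N}.
Implicit Types a b : D.

Definition has_order a b (j : nat) : bool :=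
  (0 < j) && [forall i, iter j (fun i => a (b i)) i == i].

(** The default value only serves to keep labels at least [2] without proving that
    the order is always finite. *)
Definition order a b : nat :=
  if pselect (exists j, has_order a b j) is left ex then ex_minn ex else 2.

Definition involution_edge a b : Prop :=
  [/\ forall i, a (a i) = i, forall i, b (b i) = i & a <> b].

Lemma involution_edge_irr a : ~ involution_edge a a.
Proof. by case. Qed.

Lemma involution_edge_sym a b : involution_edge a b -> involution_edge b a.
Proof. by case=> ? ? ?; split=> //; apply/nesym. Qed.

(** The products [a b] and [b a] are conjugate by [b]. *)
Lemma order_sym a b : involution_edge a b -> order a b = order b a.
Proof.
have sub a' b' j : involution_edge a' b' -> has_order a' b' j -> has_order b' a' j.
  case=> a2 b2 _ /andP[j0 /forallP ab]; rewrite /has_order j0; apply/forallP => i.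
  have conj y : iter j (fun i => b' (a' i)) (b' y) = b' (iter j (fun i => a' (b' i)) y).
    by elim: (j) => //= l ->.
  by rewrite -{1}(b2 i) conj (eqP (ab _)) b2.
move=> ab; rewrite /order (_ : has_order a b = has_order b a)//.
apply/funext => j; apply/idP/idP; apply: sub => //; exact: involution_edge_sym.
Qed.

Lemma order_ge2 a b : involution_edge a b -> 2 <= order a b.
Proof.
case=> a2 b2 ab; rewrite /order; case: pselect => // ex.
case: ex_minnP => -[|[|j]] // /andP[_ /forallP e] _; case: ab; apply/ffunP => i.
by rewrite -[RHS](eqP (e (b i))) /= b2.
Qed.

Definition involution_graph : labelled_graph :=
  LabelledGraph involution_edge_irr involution_edge_sym order_sym order_ge2.

Lemma order_eq a b k : has_order a b k -> (forall j, has_order a b j -> k <= j) ->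
  order a b = k.
Proof.
move=> hk min; rewrite /order; case: pselect => [ex|[]]; last by exists k.
by case: ex_minnP => j hj jmin; apply/eqP; rewrite eqn_leq jmin ?min.
Qed.

End InvolutionGraph.

(** * The two implications *)

(** The cosets of [K] are numbered by their position in a list, so that the group
    acts on ordinals; the stabiliser of the coset of [1] is [K]. *)
Lemma coset_action (G : groupType) (K : groupClosed G) : finite_index [set` K] ->
  exists N (psi : G -> {ffun 'I_N -> 'I_N}),
    [/\ forall i, psi 1%g i = i, forall g h i, psi (g * h)%g i = psi g (psi h i)
      & forall g, (forall i, psi g i = i) -> g \in K].
Proof.
move=> /finite_seqP[s sE]; pose cs := undup s.
have csP g : left_coset [set` K] g \in cs.
  have : range (left_coset [set` K]) (left_coset [set` K] g) by exists g.
  by rewrite sE mem_undup.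
have lt g : index (left_coset [set` K] g) cs < size cs by rewrite index_mem.
pose e g : 'I_(size cs) := Ordinal (lt g).
have e_eq g h : e g = e h -> left_coset [set` K] g = left_coset [set` K] h.
  by move=> /(congr1 val) /= eq_; rewrite -(nth_index set0 (csP g)) eq_ nth_index.
have coset_mul x g h : left_coset [set` K] g = left_coset [set` K] h ->
    left_coset [set` K] (x * g)%g = left_coset [set` K] (x * h)%g.
  have E y z : left_coset [set` K] (y * z)%g = (fun u => (y * u)%g) @` left_coset [set` K] z.
    by rewrite /left_coset image_comp; congr (_ @` _); apply/funext => u /=; rewrite mulgA.
  by rewrite !E => ->.
have rep i : exists g, e g = i.
  have : nth set0 cs i \in cs by rewrite mem_nth.
  rewrite mem_undup => si; have : [set` s] (nth set0 cs i) by [].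
  rewrite -sE => -[g _ gi]; exists g; apply: val_inj => /=.
  by rewrite gi index_uniq// undup_uniq.
have [r rK] := choice rep.
have e_mul x g : e (x * r (e g))%g = e (x * g)%g.
  by apply: val_inj => /=; congr (index _ cs); apply/coset_mul/e_eq/rK.
exists (size cs), (fun g => [ffun i => e (g * r i)%g]); split=> [i|g h i|g gi].
- by rewrite ffunE mul1g rK.
- by rewrite !ffunE e_mul mulgA.
- have := gi (e 1%g); rewrite ffunE e_mul mulg1 => /e_eq ge.
  have : left_coset [set` K] g g by exists 1%g; rewrite ?mulg1//; apply: gpred1.
  by rewrite ge => -[k kK]; rewrite mul1g => <-.
Qed.

Theorem theorem1 (G : groupType) (V : set G) (m : V -> V -> option nat)
    (cox : coxeter_system m) :
  finite_vcd G <->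
  exists D : labelled_graph,
    lg_finite D /\ exists f : K1 cox -> D, lg_morphism f.
Proof.
pose R : realType := Rdefinitions.R.
split=> [[K [fiK fcdK]]|[D [finD [phi phiM]]]].
  have [N [psi [psi1 psiM psiK]]] := coset_action fiK.
  exists (involution_graph N); split; first exact: finite_finset.
  exists (fun v : V => psi (val v)) => v w /(K1_edgeP R cox)[vw mvw].
  have {mvw}[k mvw] : exists k, m v w = Some k.
    by case: (m v w) mvw => // k _; exists k.
  have k2 := cox_ge2 cox vw mvw.
  have iterE j i : iter j (fun i => psi (val v) (psi (val w) i)) i =
      psi ((val v * val w) ^+ j)%g i.
    by elim: j => [|j IH]; rewrite ?expg0 ?psi1//= IH expgS !psiM.
  have least j : has_order (psi (val v)) (psi (val w)) j -> k <= j.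
    move=> /andP[j0 /forallP e].
    have inK : ((val v * val w) ^+ j)%g \in K.
      by apply: psiK => i; rewrite -iterE (eqP (e i)).
    pose c : subgroup_of K := SubgroupOf inK.
    have ck : (c ^+ k)%g = 1%g.
      apply: val_inj; rewrite [LHS](gmulfXn (val : subgroup_of K -> G)) /=.
      by rewrite -expgnA mulnC expgnA (cox_rel cox mvw) expg1n.
    have c1 := finite_cd_torsion_free fcdK (ltnW k2) ck.
    have [|k' mk' le] := order_gen_mul R cox vw j0; first exact: (congr1 val c1).
    by move: mk'; rewrite mvw => -[->].
  have hk : has_order (psi (val v)) (psi (val w)) k.
    rewrite /has_order (ltnW k2); apply/forallP => i.
    by rewrite iterE (cox_rel cox mvw) psi1.
  have inv (u : V) i : psi (val u) (psi (val u) i) = i by rewrite -psiM (genK cox) psi1.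
  split; last by rewrite /= /K1_label mvw /=; apply: order_eq.
  split=> // e; have : has_order (psi (val v)) (psi (val w)) 1.
    by rewrite /has_order /=; apply/forallP => i; rewrite e inv.
  by move=> /least; rewrite leqNgt k2.
have [n [c [c_lt c_inj]]] : exists n (c : D -> nat), (forall d, c d < n) /\ injective c.
  case: finD => n /card_eqPle[/pcard_leP[c] _]; exists n, c; split.
    by move=> d; have /= := @funS _ _ _ _ c d I.
  by move=> d d' e; apply: (@inj _ _ _ c); rewrite ?inE.
(* The vertices of the finite graph are numbered to serve as colours. *)
pose f (v : V) : 'I_n := Ordinal (c_lt (phi v)).
pose lab (i j : 'I_n) : nat :=
  if pselect (exists p : D * D, c p.1 = i /\ c p.2 = j) is left e
  then lg_label (projT1 (cid e)).1 (projT1 (cid e)).2 else 0.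
have labE v w : lab (f v) (f w) = lg_label (phi v) (phi w).
  rewrite /lab; case: pselect => [e|[]]; last by exists (phi v, phi w).
  by case: cid => -[d d'] /= [/c_inj -> /c_inj ->].
have lab_ok v w k : v <> w -> m v w = Some k -> f v <> f w /\ lab (f v) (f w) = k.
  move=> vw mvw; have /phiM[edge lbl] : @lg_edge (K1 cox) v w.
    by apply/(K1_edgeP R cox); rewrite mvw.
  split; last by rewrite labE lbl /= /K1_label mvw.
  by move=> /(congr1 val)/= /c_inj e; rewrite e in edge; apply: lg_edge_irr edge.
have [K [fiK normK freeK]] := detecting_subgroup R cox lab_ok.
exists K; split=> //; apply: (finite_resolution cox (f := f)) => // s t st fin.
have : m s t <> None by apply: (parabolic_label R cox _ _ fin); [left | right].
by case mst: (m s t) => [k|//] _; case: (lab_ok s t k st mst).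
Qed.
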